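(* Let $d\ge 4$ and let $K$ be a $(d-1)$-dimensional simplicial complex which is $2$-CM (doubly Cohen-Macaulay) over some field. Then $(g_0(K),g_1(K),g_2(K))$ is an $M$-sequence.
   Context: All simplicial complexes are finite abstract simplicial complexes. For a simplicial complex $L$ and a face $T\in L$ (including $T=\emptyset$), the link is $lk_L(T)=\{S\in L: T\cap S=\emptyset,\ T\cup S\in L\}$. $L$ is Cohen-Macaulay (CM) over a field $k$ if it is pure and for every face $T\in L$ (including the empty set) and every $i<\dim lk_L(T)$, the reduced homology $\tilde H_i(lk_L(T);k)$ vanishes. For a vertex $v$ of $K$, $K-v=\{T\in K: v\notin T\}$. $K$ is $2$-CM over $k$ if $K$ is CM over $k$ and for every vertex $v\in K$, $K-v$ is CM over $k$ of the same dimension as $K$. For a $(d-1)$-dimensional complex $K$ let $f_i(K)$ be the number of $i$-dimensional faces ($f_{-1}(K)=1$). The $h$-numbers are defined by $\sum_{i=0}^d h_i(K)x^{d-i}=\sum_{i=0}^d f_{i-1}(K)(x-1)^{d-i}$, and $g_0(K)=h_0(K)=1$, $g_i(K)=h_i(K)-h_{i-1}(K)$ for $1\le i\le \lfloor d/2\rfloor$. Explicitly, with $n=f_0(K)$: $g_1(K)=n-d-1$ and $g_2(K)=f_1(K)-dn+\binom{d+1}{2}$. A sequence $(a_0,a_1,\dots,a_r)$ of integers is an $M$-sequence if it is the $f$-vector of an order ideal of monomials: there is a finite nonempty set of monomials (in finitely many variables), closed under taking divisors, having exactly $a_i$ monomials of degree $i$ for $0\le i\le r$ and none of degree greater than $r$.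 *)

(* Defs.v *)
From HB Require Import structures.
From mathcomp Require Import all_boot all_order all_algebra.
From mathcomp Require Import finmap.
From mathcomp Require Import mpoly.

Set Implicit Arguments.
Unset Strict Implicit.
Unset Printing Implicit Defensive.

Import GRing.Theory.

Local Open Scope ring_scope.

(* A complex is given by its set of faces, the empty face included.  Elements *)
(* of the ambient finite type V need not all be vertices.                     *)
Section Complexes.

Variable V : finType.
Implicit Types (K L : {set {set V}}) (S T : {set V}) (v : V).

Definition simplicial_complex K : Prop :=
  set0 \in K /\ forall S T, S \in K -> T \subset S -> T \in K.

(* Faces are graded by cardinality: an i-dimensional face has i + 1 elements, *)
(* and [rank_cplx K] is dim K + 1.                                            *)
Definition rank_cplx K : nat := \max_(S in K) #|S|.

Definition pure K : Prop :=
  forall S, maxset (mem K) S -> #|S| = rank_cplx K.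

Definition link L T : {set {set V}} :=
  [set S : {set V} | [disjoint T & S] & T :|: S \in L].

Definition deletion K v : {set {set V}} := [set T in K | v \notin T].

(* Vertices are ordered by [enum_rank]; this fixes the orientation of faces.  *)
Definition incidence_sign (k : fieldType) v T : k :=
  (-1) ^+ #|[set w in T | (enum_rank w < enum_rank v)%N]|.

(* Chains are all functions on subsets of V; those of a given complex are cut *)
(* out by [chains] below.  On the basis this is the usual boundary            *)
(*   S |-> \sum_(v in S) incidence_sign v (S :\ v) *: (S :\ v),               *)
(* and vertices map to the empty face, so that the homology is reduced.       *)
Definition bd_fun (k : fieldType) (c : {ffun {set V} -> k^o}) :
    {ffun {set V} -> k^o} :=
  [ffun T : {set V} =>
    \sum_(v | v \notin T) incidence_sign k v T * c (v |: T) : k^o].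

Lemma bd_fun_linear (k : fieldType) : linear (@bd_fun k).
Proof.
move=> a c1 c2; apply/ffunP => T; rewrite !ffunE scaler_sumr -big_split /=.
by apply: eq_bigr => v _; rewrite !ffunE mulrDr; congr (_ + _); apply: mulrCA.
Qed.

HB.instance Definition _ (k : fieldType) :=
  GRing.isLinear.Build k _ _ _ (@bd_fun k) (@bd_fun_linear k).

Definition boundary (k : fieldType) : 'End({ffun {set V} -> k^o}) :=
  linfun (@bd_fun k).

Definition simplex (k : fieldType) S : {ffun {set V} -> k^o} :=
  [ffun T : {set V} => (T == S)%:R : k^o].

(* C_(q-1), Z_(q-1) and B_(q-1) of L, since q counts vertices.                *)
Definition chains (k : fieldType) L (q : nat) :
    {vspace {ffun {set V} -> k^o}} :=
  (\sum_(S in L | #|S| == q) <[simplex k S]>)%VS.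

Definition cycles (k : fieldType) L q : {vspace {ffun {set V} -> k^o}} :=
  (chains k L q :&: lker (boundary k))%VS.

Definition boundaries (k : fieldType) L q : {vspace {ffun {set V} -> k^o}} :=
  (boundary k @: chains k L q.+1)%VS.

(* The reduced homology of L over k vanishes in dimension q - 1.              *)
Definition homology_vanishes (k : fieldType) L q : Prop :=
  (cycles k L q <= boundaries k L q)%VS.

Definition CM (k : fieldType) L : Prop :=
  pure L /\
  forall T, T \in L -> forall q, (q < rank_cplx (link L T))%N ->
    homology_vanishes k (link L T) q.

Definition two_CM (k : fieldType) K : Prop :=
  CM k K /\
  forall v, [set v] \in K ->
    CM k (deletion K v) /\ rank_cplx (deletion K v) = rank_cplx K.

(* [num_faces K i] is f_(i-1)(K).                                             *)
Definition num_faces K (i : nat) : nat := #|[set S in K | #|S| == i]|.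

Definition h_poly K : {poly int} :=
  \sum_(i < (rank_cplx K).+1)
    (num_faces K i)%:R *: ('X - 1) ^+ (rank_cplx K - i).

(* Meaningful for i <= rank_cplx K only.                                      *)
Definition h_num K (i : nat) : int := (h_poly K)`_(rank_cplx K - i).

Definition g_num K (i : nat) : int :=
  if i is j.+1 then h_num K j.+1 - h_num K j else h_num K 0.

End Complexes.

(* [(m' <= m)%MM] is divisibility of monomials.                               *)
Definition M_sequence (a : seq int) : Prop :=
  exists (n : nat) (M : {fset 'X_{1..n}}),
    [/\ M != fset0,
        forall m m' : 'X_{1..n}, m \in M -> (m' <= m)%MM -> m' \in M,
        forall i : nat, (i < size a)%N ->
          a`_i = #|` [fset m in M | mdeg m == i]%fset |%:Z
      & forall m : 'X_{1..n}, m \in M -> (mdeg m < size a)%N].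

(* Main.v *)
Require Import Defs.
From mathcomp Require Import all_boot all_order all_algebra.
From HB Require Import structures.
From mathcomp Require Import finmap mpoly.
From mathcomp Require Import zify ring.
From Stdlib Require Import Classical.

(** With [n = f_0] one has [g_1 = n - d - 1] and [g_2 = f_1 - d n + C(d+1,2)], so that
    [g_2 <= C(g_1+1,2)] just says [f_1 <= C(n,2)], and the point is the lower bound
    [g_2 >= 0].  It follows from generic rigidity of the 1-skeleton in dimension [d]:
    the rank of the rigidity matrix is then [d n - C(d+1,2)], and it is at most [f_1].
    Rigidity is obtained, after Nevo, from Fogelsanger's theorem that the graph of a
    minimal (d-1)-cycle is generically d-rigid when [d >= 3].  In a 2-CM complex two
    adjacent facets lie in a common minimal cycle, so a motion that vanishes on one
    vanishes on the other; as links of codimension at least 2 are connected, it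
    vanishes everywhere.

    Bars are ordered pairs of vertices, frameworks live over the rationals, and instead
    of dividing by trivial motions one pins the vertices of one facet. *)

Set Implicit Arguments.
Unset Strict Implicit.
Unset Printing Implicit Defensive.

Import GRing.Theory Num.Theory VectorInternalTheory.

Local Open Scope ring_scope.

(** * Generic rigidity *)

(** The field of the homology and the rational coordinates never interact: rigidity sees only the
    supports of chains, while the coordinates need an infinite field, in which every nonzero
    polynomial has a non-root. The obstacle in Fogelsanger's argument is that contracting an edge uv
    of a minimal cycle gives a cycle that need not be minimal. Each minimal cycle inside it lifts to
    a chain inside the original cycle. The lift omits all faces containing uv, so by minimality it
    is not a cycle; its boundary, which the contraction kills, supplies the d - 1 common neighbours
    of u and v that a vertex split requires. Here d >= 3 matters: the sets of size d - 2 found in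
    the link of u in that boundary must be nonempty. Pinning a facet imposes d^2 conditions:
    C(d+1,2) of them remove the trivial motions, and the other C(d,2) replace the bars inside the
    facet. This is how the rank d n - C(d+1,2) appears in the count. *)

Lemma lker0_addZ_poly (F : fieldType) (U W : vectType F) (f g : 'Hom(U, W)) :
  lker f == 0%VS ->
  exists2 q : {poly F}, q != 0 &
    forall t, q.[t] != 0 -> lker (f + t *: g) == 0%VS.
Proof.
move=> kf.
(* Composed with the left inverse of [f], the pencil [f + t *: g] becomes [1 + t *: h], whose
   determinant is a polynomial in [t] with value 1 at 0. *)
pose h : 'End(U) := (f^-1 \o g)%VF.
pose H : 'M[F]_(dim U) := lin1_mx (v2r \o h \o r2v).
exists (\det (1%:M + 'X *: map_mx polyC H)).
  apply/eqP => /(congr1 (horner^~ 0)); rewrite horner0.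
  rewrite -horner_evalE -det_map_mx map_mxD map_mx1 map_mxZ.
  by rewrite /= horner_evalE hornerX scale0r addr0 det1 => /eqP; rewrite oner_eq0.
move=> t; rewrite -horner_evalE -det_map_mx map_mxD map_mx1 map_mxZ.
have -> : map_mx (horner_eval t) (map_mx polyC H) = H.
  by apply/matrixP => i j; rewrite !mxE horner_evalE hornerC.
rewrite /= horner_evalE hornerX -unitfE -/(_ \in unitmx) => uH.
apply/lker0P/raddf_inj => x.
rewrite /= add_lfunE scale_lfunE => x0.
have : (f^-1)%VF (f x + t *: g x) = 0 by rewrite x0 linear0.
rewrite linearD linearZ /= lker0_lfunK // => hx.
have : v2r x *m (1%:M + t *: H) = 0.
  rewrite mulmxDr mulmx1 -scalemxAr mul_rV_lin1 /= v2rK.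
  by rewrite -linearZ -linearD /= comp_lfunE hx linear0.
move=> /(congr1 (mulmx^~ (invmx (1%:M + t *: H)))).
rewrite mul0mx -mulmxA mulmxV // mulmx1 => /(congr1 r2v).
by rewrite v2rK linear0.
Qed.

Lemma poly_nonroot (q : {poly rat}) : q != 0 -> exists t, q.[t] != 0.
Proof.
move=> q0; apply: NNPP => nt.
pose s := [seq i%:R : rat | i <- iota 0 (size q)].
have := @max_poly_roots _ q s q0; rewrite size_map size_iota ltnn => H.
suff: false by []; apply: H.
  apply/allP => t _; apply: contraT => qt; case: nt; exists t.
  by rewrite -/(root q t).
rewrite map_inj_uniq ?iota_uniq // => i j /eqP.
by rewrite eqr_nat => /eqP.
Qed.

Section Rigidity.
Variables (d : nat) (V : finType).
Implicit Types (E : {set V * V}) (Z : {set V}).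

Local Notation motions := {ffun V -> 'rV[rat]_d}.
Local Notation directions := {ffun V * V -> 'rV[rat]_d}.
Local Notation placements := {ffun V -> 'rV[rat]_d}.

(** Bars carry directions independent of any placement: in the limit of a vertex split two vertices
    coincide, yet the bar between them must keep a direction. *)
Definition motion E (D : directions) (m : motions) :=
  forall e, e \in E -> (m e.1 - m e.2) *m (D e)^T = 0.

Definition stiff E (D : directions) Z := forall m : motions,
  motion E D m -> (forall z, z \in Z -> m z = 0) -> m = 0.

Definition pdir (p : placements) : directions := [ffun e => p e.1 - p e.2].

Definition rigidity_fun E (D : directions) Z (m : motions) :
    {ffun {e | e \in E} -> 'M[rat]_1} * {ffun {z | z \in Z} -> 'rV[rat]_d} :=
  ([ffun e => (m (val e).1 - m (val e).2) *m (D (val e))^T],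
   [ffun z => m (val z)]).

Lemma rigidity_fun_linear E D Z : linear (rigidity_fun E D Z).
Proof.
move=> a m1 m2; congr (_, _); apply/ffunP => x; rewrite !ffunE //=.
by rewrite opprD addrACA -scalerBr mulmxDl scalemxAl.
Qed.
HB.instance Definition _ E D Z :=
  GRing.isLinear.Build _ _ _ _ (rigidity_fun E D Z) (rigidity_fun_linear E D Z).

Lemma stiffP E D Z : stiff E D Z <-> lker (linfun (rigidity_fun E D Z)) == 0%VS.
Proof.
split=> [st | /lker0P inj m mE mZ].
  apply/lker0P/raddf_inj => m; rewrite /= lfunE /= => -[m1 m2]; apply: st.
    by move=> e eE; have /ffunP/(_ (Sub e eE)) := m1; rewrite !ffunE /= => ->.
  by move=> z zZ; have /ffunP/(_ (Sub z zZ)) := m2; rewrite !ffunE /= => ->.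
apply: inj => /=; rewrite linear0 lfunE /=; congr (_, _).
  by apply/ffunP => -[e eE]; rewrite !ffunE /= mE.
by apply/ffunP => -[z zZ]; rewrite !ffunE /= mZ.
Qed.

Lemma stiff_line E D0 D1 Z : stiff E D0 Z ->
  exists2 q : {poly rat}, q != 0 &
    forall t, q.[t] != 0 -> stiff E (D0 + t *: D1) Z.
Proof.
move/stiffP => /lker0_addZ_poly.
(* [rigidity_fun] is affine in the directions, with the pinned coordinates as constant part;
   subtracting its value at 0 leaves the linear part. *)
move/(_ (linfun (rigidity_fun E D1 Z) - linfun (rigidity_fun E 0 Z))).
case=> q q0 qP; exists q => // t /qP; rewrite stiffP.
suff -> : linfun (rigidity_fun E D0 Z) + t *: (linfun (rigidity_fun E D1 Z) -
   linfun (rigidity_fun E 0 Z)) = linfun (rigidity_fun E (D0 + t *: D1) Z) by [].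
apply/lfunP => m; rewrite add_lfunE scale_lfunE add_lfunE opp_lfunE !lfunE /=.
congr (_, _); apply/ffunP => x; rewrite !ffunE; last by rewrite subrr scaler0 addr0.
by rewrite trmx0 mulmx0 subr0 [(_ + _)^T]linearD /= [(_ *: _)^T]linearZ /= mulmxDr -scalemxAr.
Qed.

Lemma stiff_sub E E' D Z Z' :
  E \subset E' -> Z \subset Z' -> stiff E D Z -> stiff E' D Z'.
Proof.
move=> sE sZ st m mE mZ; apply: st => [e eE | z zZ].
  by apply: mE; apply: (subsetP sE).
by apply: mZ; apply: (subsetP sZ).
Qed.

Lemma stiff_count E D Z : stiff E D Z -> (#|V| * d <= #|E| + #|Z| * d)%N.
Proof.
move/stiffP => ker0.
have /= := dimvS (subvf (linfun (rigidity_fun E D Z) @: fullv)%VS).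
rewrite limg_dim_eq ?(eqP ker0) ?capv0 // !dimvf => le_dim.
have : (#|V| * (1 * d) <= #|{: {e | e \in E}}| * (1 * 1) +
                          #|{: {z | z \in Z}}| * (1 * d))%N := le_dim.
by rewrite !card_sig !mul1n muln1.
Qed.

Definition generically_stiff E Z := exists p, stiff E (pdir p) Z.

Lemma pdir_line p q t : pdir (p + t *: (q - p)) = pdir p + t *: (pdir q - pdir p).
Proof.
apply/ffunP => e; rewrite !ffunE opprD addrACA -scalerBr.
by rewrite opprD addrACA [in RHS]opprD.
Qed.

Lemma generically_stiff_line E Z p q : stiff E (pdir p) Z ->
  exists2 P : {poly rat}, P != 0 &
    forall t, P.[t] != 0 -> stiff E (pdir (p + t *: (q - p))) Z.
Proof.
move=> /(stiff_line (pdir q - pdir p)) [P P0 H]; exists P => // t /H.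
by rewrite pdir_line.
Qed.

(** On the line joining a placement good for the tail to one good for the head, each condition fails
    for finitely many parameters only. The two polynomials are measured from opposite ends, hence
    the substitution of [1 - 'X]. *)
Lemma generically_stiff_seq (s : seq ({set V * V} * {set V})) :
  (forall x, x \in s -> generically_stiff x.1 x.2) ->
  exists p, forall x, x \in s -> stiff x.1 (pdir p) x.2.
Proof.
elim: s => [|x s IH] H; first by exists 0.
have [|p pP] := IH; first by move=> y ys; apply: H; rewrite inE ys orbT.
have [q qP] := H x (mem_head _ _).
have {}pP : exists2 P : {poly rat}, P != 0 & forall t, P.[t] != 0 ->
    forall x, x \in s -> stiff x.1 (pdir (p + t *: (q - p))) x.2.
  elim: s {IH H} pP => [|y s IH] pP; first by exists 1; rewrite ?oner_eq0.
  have [|P P0 PP] := IH; first by move=> z zs; apply: pP; rewrite inE zs orbT.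
  have [Q Q0 QP] := generically_stiff_line q (pP y (mem_head _ _)).
  exists (P * Q); first by rewrite mulf_neq0.
  move=> t; rewrite hornerM mulf_eq0 negb_or => /andP[Pt Qt] z.
  by rewrite inE => /predU1P[-> |]; [apply: QP | apply: PP].
have [P P0 PP] := pP.
have [Q Q0 QP] := generically_stiff_line p qP.
have QQ0 : Q \Po (1 - 'X) != 0.
  apply/eqP => /(congr1 (fun r => r \Po (1 - 'X))).
  rewrite comp_poly0 -comp_polyA linearB /= rmorph1 /= comp_polyX subKr.
  by rewrite comp_polyXr => Q00; rewrite Q00 eqxx in Q0.
have [t] := poly_nonroot (mulf_neq0 P0 QQ0).
rewrite hornerM horner_comp !hornerE mulf_eq0 negb_or => /andP[Pt Qt].
exists (p + t *: (q - p)) => y; rewrite inE => /predU1P[-> |]; last exact: PP.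
have -> : p + t *: (q - p) = q + (1 - t) *: (p - q); last exact: QP.
by rewrite -[p - q]opprB scalerN -scaleNr opprB scalerBl scale1r opprB
  [RHS]addrC -[RHS]addrA subrK addrC.
Qed.

(** There are finitely many pairs of a bar set and a pinned set; excluded middle selects those that
    some placement makes stiff, and one placement then serves them all. *)
Lemma generic_placement :
  exists p, forall E Z, generically_stiff E Z -> stiff E (pdir p) Z.
Proof.
suff [p pP] : exists p, forall x, x \in enum [set: {set V * V} * {set V}] ->
    generically_stiff x.1 x.2 -> stiff x.1 (pdir p) x.2.
  by exists p => E Z; apply: (pP (E, Z)); rewrite mem_enum inE.
elim: (enum _) => [|x s [p pP]]; first by exists 0.
have [s' sP] : exists s' : seq ({set V * V} * {set V}),
    (forall y, y \in s' -> generically_stiff y.1 y.2) /\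
    (forall y, y \in x :: s -> generically_stiff y.1 y.2 -> y \in s').
  elim: (x :: s) => [|y r [r' [r1 r2]]]; first by exists [::].
  case: (classic (generically_stiff y.1 y.2)) => gy; [exists (y :: r') | exists r']; split.
  - by move=> z; rewrite inE => /predU1P[-> |]; [|apply: r1].
  - by move=> z; rewrite !inE => /predU1P[-> | zr gz]; rewrite ?eqxx // r2 ?orbT.
  - by [].
  - by move=> z; rewrite !inE => /predU1P[-> // |]; apply: r2.
have [q qP] := generically_stiff_seq (proj1 sP).
by exists q => y ys gy; apply: qP; apply: (proj2 sP).
Qed.

Lemma generically_stiff_star (v : V) (W : {set V}) : #|W| = d -> v \notin W ->
  generically_stiff [set (v, w) | w in W] [set~ v].
Proof.
(* The vertices of [W] go to the basis vectors and [v] to the origin, since [index] returns d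
   outside [W]; each bar then reads off one coordinate of the motion at [v]. *)
move=> cW vW; exists [ffun x => \row_(k < d) (index x (enum W) == k)%:R].
move=> m mE mZ; apply/ffunP => x; rewrite ffunE.
have [->|xv] := eqVneq x v; last by apply: mZ; rewrite !inE.
apply/rowP => k; rewrite mxE.
have kW : (k < size (enum W))%N by rewrite -cardE cW.
have wW : nth v (enum W) k \in W by rewrite -mem_enum mem_nth.
have /= := mE (v, nth v (enum W) k) (imset_f _ wW).
rewrite [m (nth _ _ _)]mZ ?inE; last by apply/eqP => E; rewrite E (negbTE vW) in wW.
rewrite subr0 !ffunE /= => /matrixP/(_ 0 0); rewrite !mxE (bigD1 k) //= big1.
  rewrite !mxE index_uniq ?enum_uniq // eqxx memNindex ?mem_enum // -cardE cW.
  by rewrite gtn_eqF // sub0r addr0 mulrN mulr1 => /eqP; rewrite oppr_eq0 => /eqP.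
move=> j jk; rewrite !mxE index_uniq ?enum_uniq // memNindex ?mem_enum //.
rewrite -cardE cW gtn_eqF //; have -> : (k == j :> nat) = false.
  by rewrite eq_sym; apply: negbTE.
by rewrite subrr mulr0.
Qed.

Lemma generically_stiff2 E1 Z1 E2 Z2 : generically_stiff E1 Z1 -> generically_stiff E2 Z2 ->
  exists p, stiff E1 (pdir p) Z1 /\ stiff E2 (pdir p) Z2.
Proof.
move=> g1 g2; have [|p pP] := @generically_stiff_seq [:: (E1, Z1); (E2, Z2)].
  by move=> x; rewrite !inE => /orP[] /eqP ->.
exists p; split; first by have := pP _ (mem_head _ _).
by apply: (pP (E2, Z2)); rewrite !inE eqxx orbT.
Qed.

(* Vertex splitting: as [v] moves to [u] along a fixed line the bar [uv] keeps its
   direction, so in the limit a motion agrees at [u] and [v] and becomes a motion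
   of the contracted framework. *)
Lemma generically_stiff_split E E' Z Z' (u v : V) (N : {set V}) :
  u != v -> (u, v) \in E -> #|N|.+1 = d -> u \notin N -> v \notin N ->
  (forall w, w \in N -> (u, w) \in E /\ (v, w) \in E) ->
  let fold x := if x == v then u else x in
  (forall e, e \in E' -> e.1 != v /\ e.2 != v) ->
  (forall e, e \in E' ->
    exists2 e0, e0 \in E & e = (fold e0.1, fold e0.2)) ->
  (forall z, z \in Z' -> z != v -> exists2 z0, z0 \in Z & z = fold z0) ->
  generically_stiff E' (v |: Z') -> generically_stiff E Z.
Proof.
move=> uv uvE cN uN vN NE fold E'v E'E Z'Z g'.
have cW : #|v |: N| = d by rewrite cardsU1 vN.
have uW : u \notin v |: N by rewrite !inE negb_or uv.
have [p [p1 p2]] := generically_stiff2 g' (generically_stiff_star cW uW).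
pose p_ t : placements := [ffun x => if x == v then p u + t *: (p v - p u) else p x].
pose D0 : directions := [ffun e => if e == (u, v) then p u - p v else pdir (p_ 0) e].
pose D1 : directions :=
  [ffun e => if e == (u, v) then 0 else pdir (p_ 1) e - pdir (p_ 0) e].
have st0 : stiff E D0 Z.
  move=> m mE mZ.
  (* In the limit the bars from [u] and from [v] to a vertex of [N] have the same direction. So
     [m u - m v] is orthogonal to these d - 1 directions and to that of [uv], and [p2] says that
     such a vector is 0. *)
  have muv : m u = m v.
    apply/eqP; rewrite -subr_eq0; apply/eqP.
    pose mu : motions := [ffun x => if x == u then m u - m v else 0].
    suff /ffunP/(_ u) : mu = 0 by rewrite !ffunE eqxx.
    apply: p2 => [_ /imsetP[w wN ->] | z]; last by rewrite !inE ffunE => /negbTE->.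
    rewrite /= !ffunE /= eqxx; have wu : w != u by apply: contraNneq uW => <-.
    rewrite (negbTE wu) subr0.
    move: wN; rewrite !inE => /predU1P[-> |wN].
      by have := mE _ uvE; rewrite ffunE eqxx.
    have wv : w != v by apply: contraNneq vN => <-.
    have [uwE vwE] := NE w wN.
    have := mE _ uwE; have := mE _ vwE; rewrite !ffunE /= !xpair_eqE.
    rewrite !(negbTE wv) !andbF !eqxx !(negbTE uv) scale0r addr0 => vw uw.
    by rewrite -(subrKA (m w)) mulmxDl uw -opprB mulNmx vw subr0.
  pose m' : motions := [ffun x => if x == v then 0 else m x].
  have m'0 : m' = 0.
    apply: p1 => [e eE' | z].
      have [e1 e2] := E'v e eE'; have [e0 e0E def_e] := E'E e eE'.
      rewrite !ffunE (negbTE e1) (negbTE e2).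
      have p0E x : p (fold x) = p_ 0 x.
        by rewrite ffunE /fold scale0r addr0; case: eqP.
      have m0E x : m (fold x) = m x by rewrite /fold; case: eqP => // ->.
      rewrite def_e /= !p0E !m0E.
      have [-> /= |ne0] := eqVneq e0 (u, v); first by rewrite muv subrr mul0mx.
      by have := mE _ e0E; rewrite !ffunE /= (negbTE ne0).
    rewrite !inE => /predU1P[-> |zZ']; rewrite ffunE ?eqxx //.
    have [//|zv] := eqVneq z v; have [z0 z0Z ->] := Z'Z z zZ' zv.
    by rewrite /fold; case: eqP => [z0v|_]; rewrite ?muv -?z0v mZ.
  have mx x : x != v -> m x = 0.
    by move=> xv; have /ffunP/(_ x) := m'0; rewrite !ffunE (negbTE xv).
  by apply/ffunP => x; rewrite ffunE; have [-> |/mx//] := eqVneq x v; rewrite -muv mx.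
have [q q0 qP] := stiff_line D1 st0.
(* The factor ['X] forces [t] to be nonzero: the bar [uv] of [p_ t] has direction
   [t *: (p u - p v)], which must impose the same condition as [p u - p v]. *)
have [|t] := @poly_nonroot (q * 'X); first by rewrite mulf_neq0 ?polyX_eq0.
rewrite hornerM hornerX mulf_eq0 negb_or => /andP[/qP st t0].
exists (p_ t) => m mE; apply: st => e eE; have := mE e eE.
rewrite !ffunE; case: (eqVneq e (u, v)) => [-> /= | _ ].
  rewrite eqxx (negbTE uv) scaler0 addr0.
  rewrite opprD addNKr -scalerN opprB => /eqP.
  by rewrite [(_ *: _)^T]linearZ /= -scalemxAr scaler_eq0 (negbTE t0) => /eqP.
suff /ffunP/(_ e) : pdir (p_ t) = pdir (p_ 0) + t *: (pdir (p_ 1) - pdir (p_ 0)).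
  by rewrite !ffunE /= => ->.
rewrite -pdir_line; congr pdir; apply/ffunP => x; rewrite !ffunE.
case: ifP => _; last by rewrite subrr scaler0 addr0.
by rewrite scale0r addr0 scale1r subrKC.
Qed.
End Rigidity.

(** * Chains, cycles and edge contraction *)

Section Chains.
Variables (k : fieldType) (V : finType).
Implicit Types (c : {ffun {set V} -> k^o}) (S T F : {set V}) (A : {set {set V}}).

Local Notation s := (@incidence_sign V k).
Local Notation bd := (@bd_fun V k).

Lemma sign_sq v T : s v T * s v T = 1.
Proof. by rewrite -expr2 sqrr_sign. Qed.

Lemma sign_neq0 v T : s v T != 0.
Proof. by rewrite signr_eq0. Qed.

Lemma sign_setU1 v w T : v \notin T ->
  s w (v |: T) = (-1) ^+ (enum_rank v < enum_rank w)%N * s w T.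
Proof.
move=> vT; rewrite /incidence_sign -exprD; congr (_ ^+ _).
set A := [set _ in T | _]; have -> : [set x in v |: T | (enum_rank x < enum_rank w)%N] =
    if (enum_rank v < enum_rank w)%N then v |: A else A.
  apply/setP => x; case: ifP => vw; rewrite /A !inE; have [-> | _ //] := eqVneq x v.
    by rewrite vw.
  by rewrite vw !andbF.
by case: ifP => // _; rewrite cardsU1 !inE (negbTE vT).
Qed.

Lemma sign_exchange v w T : v != w -> v \notin T -> w \notin T ->
  s v T * s w (v |: T) = - (s w T * s v (w |: T)).
Proof.
move=> vw vT wT; rewrite !sign_setU1 //.
have : enum_rank v != enum_rank w by rewrite (inj_eq enum_rank_inj).
by rewrite neq_ltn => /orP[] H; rewrite H ltnNge (ltnW H) /=; ring.
Qed.

Lemma sign_setU1_mul v w T : v != w -> v \notin T -> w \notin T ->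
  s w (v |: T) * s v (w |: T) = - (s v T * s w T).
Proof.
move=> vw vT wT; rewrite !sign_setU1 //.
have : enum_rank v != enum_rank w by rewrite (inj_eq enum_rank_inj).
by rewrite neq_ltn => /orP[] H; rewrite H ltnNge (ltnW H) /=; ring.
Qed.

(** The vanishing on the diagonal is a separate hypothesis because antisymmetry does not imply it in
    characteristic 2. *)
Lemma sum_antisymmetric (f : V -> V -> k) :
  (forall v w, f v w = - f w v) -> (forall v, f v v = 0) ->
  \sum_v \sum_w f v w = 0.
Proof.
move=> fA f0; rewrite pair_big /=.
rewrite (bigID (fun p : V * V => (enum_rank p.1 < enum_rank p.2)%N)) /=.
rewrite [X in _ + X](bigID (fun p : V * V => p.1 == p.2)) /=.
rewrite [X in _ + (X + _)]big1 ?add0r; last first.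
  by case=> v w /andP[_ /eqP /= ->]; rewrite f0.
pose sw (p : V * V) := (p.2, p.1).
have swK : involutive sw by case.
rewrite [X in _ + X](reindex_inj (inv_inj swK)) /=.
have -> : \sum_(p : V * V | (enum_rank p.1 < enum_rank p.2)%N) f p.1 p.2 =
    \sum_(p : V * V | ~~ (enum_rank p.2 < enum_rank p.1)%N && (p.2 != p.1)) f p.1 p.2.
  apply: eq_bigl; move=> [v w] /=; rewrite -leqNgt ltn_neqAle andbC; congr (_ && _).
  by rewrite (inj_eq val_inj) (inj_eq enum_rank_inj) eq_sym.
by rewrite -big_split big1 //= => p _; rewrite fA addNr.
Qed.

Lemma bd_bd c : bd (bd c) = 0.
Proof.
apply/ffunP => T; rewrite !ffunE.
pose f v w : k := if (v != w) && (v \notin T) && (w \notin T) then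
  s v T * (s w (v |: T) * c (w |: (v |: T))) else 0.
rewrite -[RHS](@sum_antisymmetric f); last first.
- by move=> v; rewrite /f eqxx.
- move=> v w; rewrite /f eq_sym andbAC; case: ifP; last by rewrite oppr0.
  move=> /andP[/andP[wv wT] vT]; rewrite mulrA sign_exchange 1?eq_sym // mulNr -mulrA.
  by rewrite setUCA.
rewrite big_mkcond; apply: eq_bigr => v _; case: ifPn => vT; last first.
  by rewrite big1 // => w _; rewrite /f (negbTE vT) andbF.
rewrite ffunE big_distrr /= big_mkcond; apply: eq_bigr => w _.
by rewrite /f vT andbT !inE negb_or eq_sym.
Qed.

Definition supp c : {set {set V}} := [set F | c F != 0].
Definition verts c : {set V} := cover (supp c).
Definition homogeneous q c := forall F, F \in supp c -> #|F| = q.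

Definition restrict A c : {ffun {set V} -> k^o} := [ffun F => if F \in A then c F else 0].

Definition link_chain v c : {ffun {set V} -> k^o} :=
  [ffun T : {set V} => if v \in T then 0 else s v T * c (v |: T)].

Definition cone_chain v c : {ffun {set V} -> k^o} :=
  [ffun T : {set V} => if v \in T then s v (T :\ v) * c (T :\ v) else 0].

(* The chain map induced by the simplicial map that sends [v] to [u]. *)
Definition contract u v c : {ffun {set V} -> k^o} :=
  [ffun T : {set V} => if v \in T then 0 else
     if u \in T then c T + s u (T :\ u) * s v (T :\ u) * c (v |: T :\ u) else c T].

Lemma suppE c F : (F \in supp c) = (c F != 0). Proof. by rewrite inE. Qed.

Lemma supp_eq0 c : (supp c == set0) = (c == 0).
Proof.
apply/eqP/eqP => [c0 | ->]; last by apply/setP => F; rewrite !inE ffunE eqxx.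
apply/ffunP => F; rewrite ffunE; apply/eqP; apply: contraT => cF.
by have /setP/(_ F) := c0; rewrite !inE cF.
Qed.

Lemma bd_link v c : bd (link_chain v c) = - link_chain v (bd c).
Proof.
apply/ffunP => T; rewrite !ffunE; case: ifPn => vT.
  by rewrite oppr0 big1 // => x xT; rewrite ffunE !inE vT orbT mulr0.
rewrite (bigD1 v) //= ffunE setU11 mulr0 add0r mulr_sumr -sumrN.
apply: eq_big => [x | x /andP[xT xv]]; first by rewrite !inE negb_or andbC.
rewrite ffunE !inE eq_sym (negbTE xv) (negbTE vT) /= mulrA sign_exchange //.
by rewrite mulNr -mulrA setUCA.
Qed.

Lemma bd_cone v c : (forall F, F \in supp c -> v \notin F) -> bd c = 0 ->
  bd (cone_chain v c) = c.
Proof.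
move=> cv c0; apply/ffunP => T; rewrite ffunE.
have [vT|vT] := boolP (v \in T); last first.
  rewrite (bigD1 v) //= ffunE setU11 setU1K // mulrA sign_sq mul1r big1 ?addr0 //.
  move=> x /andP[xT xv]; rewrite ffunE !inE eq_sym (negbTE xv) (negbTE vT) /=.
  exact: mulr0.
have -> : c T = 0 by apply/eqP; apply: contraTT vT => cT; apply: cv; rewrite suppE.
rewrite -(setD1K vT); set T1 := T :\ v; have vT1 : v \notin T1 by rewrite !inE eqxx.
have /ffunP/(_ T1) := c0; rewrite !ffunE (bigD1 v) //=.
have -> : c (v |: T1) = 0.
  by apply/eqP; apply: contraTT (setU11 v T1) => cT; apply: cv; rewrite suppE.
rewrite mulr0 add0r => /(congr1 (fun a => - (s v T1 * a))).
rewrite mulr0 oppr0 => e0; rewrite -[RHS]e0 mulr_sumr -sumrN.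
apply: eq_big => [x | x]; first by rewrite !inE negb_or andbC.
rewrite !inE negb_or => /andP[xv xT]; rewrite ffunE !inE eqxx orbT.
have -> : (x |: (v |: T1)) :\ v = x |: T1.
  by rewrite setUCA setU1K // !inE eqxx orbF eq_sym.
by rewrite [LHS]mulrA sign_setU1_mul ?mulNr ?mulrA // 1?eq_sym // !inE.
Qed.

Lemma bd_contract u v c : u != v -> bd (contract u v c) = contract u v (bd c).
Proof.
move=> uv; apply/ffunP => T; rewrite [LHS]ffunE [RHS]ffunE.
have [vT|vT] := boolP (v \in T).
  by rewrite big1 // => x xT; rewrite ffunE !inE vT orbT mulr0.
have [uT|uT] := boolP (u \in T); last first.
  rewrite [RHS]ffunE [LHS](bigD1 v) //= [RHS](bigD1 v) //=.
  rewrite [X in _ + X = _](bigD1 u) /=; last by rewrite uT.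
  rewrite [X in _ = _ + X](bigD1 u) /=; last by rewrite uT.
  rewrite [contract _ _ _ (v |: T)]ffunE setU11 mulr0 add0r.
  rewrite [contract _ _ _ (u |: T)]ffunE !inE [v == u]eq_sym (negbTE uv) (negbTE vT).
  rewrite eqxx /= setU1K // mulrDr !mulrA sign_sq mul1r addrAC addrC.
  congr (_ + (_ + _)); apply: eq_bigr => x /andP[/andP[xT xv] xu].
  rewrite ffunE !inE [v == x]eq_sym (negbTE xv) (negbTE vT).
  by rewrite [u == x]eq_sym (negbTE xu) (negbTE uT).
rewrite -(setD1K uT); set S := T :\ u.
have uS : u \notin S by rewrite !inE eqxx.
have vS : v \notin S by rewrite !inE negb_and vT orbT.
have uvS : u \notin v |: S by rewrite in_setU1 negb_or uv.
have vuS : v \notin u |: S by rewrite in_setU1 negb_or eq_sym uv.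
rewrite setU1K // [bd c _]ffunE [bd c (v |: _)]ffunE [LHS](bigD1 v) //=.
rewrite [contract _ _ _ (v |: _)]ffunE.
rewrite setU11 mulr0 add0r [X in _ = X + _](bigD1 v) //=.
rewrite [X in _ = _ + _ * X](bigD1 u) //= mulrDr addrACA.
rewrite [X in _ = X + _](_ : _ = 0) ?add0r; last first.
  have e : s u S * s v S * s u (v |: S) = - s v (u |: S).
    by rewrite -mulrA sign_exchange 1?eq_sym // mulrN mulrA sign_sq mul1r.
  by rewrite mulrA e mulNr (setUCA [set u]) subrr.
rewrite mulr_sumr [X in _ = _ + X](eq_bigl (fun x => (x \notin u |: S) && (x != v))).
  rewrite -big_split; apply: eq_bigr => x /andP[xuS xv] /=.
  move: (xuS); rewrite in_setU1 negb_or => /andP[xu xS].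
  rewrite ffunE !in_setU1 [v == x]eq_sym (negbTE xv) [v == u]eq_sym (negbTE uv).
  rewrite (negbTE vS) eqxx orbT /= setUCA setU1K; last first.
    by rewrite in_setU1 negb_or eq_sym xu.
  rewrite mulrDr; congr (_ + _); rewrite (setUCA [set v]) !mulrA; congr (_ * _).
  have -> : s x (u |: S) * s u (x |: S) = - (s u S * s x S).
    by rewrite sign_setU1_mul // eq_sym.
  rewrite -[in RHS]mulrA sign_exchange 1?eq_sym // mulrN mulNr.
  by rewrite !mulrA.
by move=> x; rewrite !in_setU1 !negb_or -!andbA; do !bool_congr.
Qed.

(** Otherwise the boundary coefficient at [F :\ r] would be the single nonzero term coming from
    [F]. *)
Lemma cycle_other c F r : bd c = 0 -> F \in supp c -> r \in F ->
  exists2 y, y \notin F & y |: F :\ r \in supp c.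
Proof.
move=> c0; rewrite suppE => cF rF; apply: NNPP => no.
have /ffunP/(_ (F :\ r)) := c0; rewrite !ffunE (bigD1 r) /=; last by rewrite !inE eqxx.
rewrite setD1K // big1 => [/eqP | y /andP[]].
  by rewrite addr0 mulf_eq0 (negbTE (sign_neq0 _ _)) (negbTE cF).
rewrite !inE negb_and negbK => /orP[/eqP -> /eqP // | yF yr].
apply/eqP; rewrite mulf_eq0; apply/orP; right; apply: contraT => cy; case: no.
by exists y; rewrite // suppE.
Qed.

(** The supports are the circuits of the linear matroid that the boundary map defines on the subsets
    of [V]. *)
Definition minimal_cycle c := [/\ c != 0, bd c = 0 & forall c1, c1 != 0 ->
  bd c1 = 0 -> supp c1 \subset supp c -> supp c1 = supp c].

Lemma bdZD a c1 c2 : bd c1 = 0 -> bd c2 = 0 -> bd (c1 + a *: c2) = 0.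
Proof. by move=> h1 h2; rewrite linearD linearZ /= h1 h2 scaler0 addr0. Qed.

Lemma cancel_facet c c1 G : supp c1 \subset supp c -> G \in supp c1 ->
  supp (c - (c G / c1 G) *: c1) \proper supp c.
Proof.
move=> s1; rewrite suppE => G1; apply/properP; split.
  apply/subsetP => F; rewrite !suppE; apply: contraNneq => cF.
  have : c1 F == 0.
    by apply: contraTT (eqxx (0 : k)) => /=; rewrite -suppE => /(subsetP s1); rewrite suppE cF.
  by rewrite !ffunE cF => /eqP ->; rewrite scaler0 subr0.
exists G; first by apply: (subsetP s1); rewrite suppE.
by rewrite suppE !ffunE negbK /GRing.scale /= divfK // subrr.
Qed.

(** A cycle of strictly smaller support either contains [F] and replaces [c], or misses [F] and can
    be used to cancel another face of [c] without changing the coefficient at [F]. Either way the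
    support shrinks. *)
Lemma minimal_cycle_through c F : bd c = 0 -> F \in supp c ->
  exists c1, [/\ minimal_cycle c1, supp c1 \subset supp c & F \in supp c1].
Proof.
move: {2}_.+1 (ltnSn #|supp c|) => n; elim: n c => // n IH c cn c0 cF.
have [mc|nmc] := classic (minimal_cycle c); first by exists c.
have [c1 [c1n c10 s1 ne1]] : exists c1, [/\ c1 != 0, bd c1 = 0,
    supp c1 \subset supp c & supp c1 != supp c].
  apply: NNPP => no; apply: nmc; split => //.
    by rewrite -supp_eq0; apply/set0Pn; exists F.
  by move=> c1 h1 h2 h3; apply: NNPP => /eqP h4; apply: no; exists c1.
have sub c2 : bd c2 = 0 -> supp c2 \proper supp c -> F \in supp c2 ->
    exists c1, [/\ minimal_cycle c1, supp c1 \subset supp c & F \in supp c1].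
  move=> c20 s2 F2; have [|//|c3 [m3 s3 F3]] := IH c2 _ c20.
    by apply: leq_trans (proper_card s2) _.
  by exists c3; split=> //; apply: subset_trans s3 (proper_sub s2).
have [F1|F1] := boolP (F \in supp c1); first by apply: (sub c1); rewrite ?properEneq ?ne1.
move: (c1n); rewrite -supp_eq0 => /set0Pn[G G1].
apply: sub (cancel_facet s1 G1) _; first by rewrite -scaleNr; apply: bdZD.
by move: F1; rewrite !suppE !ffunE negbK => /eqP ->; rewrite scaler0 subr0 -suppE.
Qed.

(** Repeated cancellation writes [c] as a combination of minimal cycles inside its support, and
    restriction to [A] fixes or kills each of them. *)
Lemma restrict_cycle A c : bd c = 0 ->
  (forall c1, minimal_cycle c1 -> supp c1 \subset supp c ->
     supp c1 \subset A \/ [disjoint supp c1 & A]) ->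
  bd (restrict A c) = 0.
Proof.
move: {2}_.+1 (ltnSn #|supp c|) => n; elim: n c => // n IH c cn c0 H.
have [c00|] := eqVneq c 0.
  suff -> : restrict A c = 0 by rewrite linear0.
  by apply/ffunP => F; rewrite !ffunE c00 ffunE if_same.
rewrite -supp_eq0 => /set0Pn[F cF].
have [c1 [m1 s1 F1]] := minimal_cycle_through c0 cF.
have [_ c10 _] := m1; have prop := cancel_facet s1 F1; set a := c F / c1 F in prop.
have -> : restrict A c = restrict A (c - a *: c1) + a *: restrict A c1.
  apply/ffunP => G; rewrite !ffunE; case: ifP => _; first by rewrite subrK.
  by rewrite scaler0 addr0.
apply: bdZD.
  apply: IH.
  - exact: leq_trans (proper_card prop) _.
  - by rewrite -scaleNr; apply: bdZD.
  - by move=> c2 m2 s2; apply: H => //; apply: subset_trans s2 (proper_sub prop).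
case: (H c1 m1 s1) => [sA|dA].
  suff -> : restrict A c1 = c1 by [].
  apply/ffunP => G; rewrite ffunE; case: ifPn => // GA; apply/esym/eqP.
  by apply: contraNT GA; rewrite -suppE => /(subsetP sA).
suff -> : restrict A c1 = 0 by rewrite linear0.
apply/ffunP => G; rewrite !ffunE; case: ifPn => // GA; apply/eqP.
by apply: contraTT GA; rewrite -suppE => G1; rewrite (disjointFr dA).
Qed.

End Chains.

(** * Rigidity of minimal cycles *)

(** Elements of [V] outside [Y] meet no bar and would move freely, which is why pinned sets have the
    form [F :|: ~: Y]. For the same reason a motion may be reset to 0 there. *)
Lemma stiff_vanish (d : nat) (V : finType) (E : {set V * V}) D (F Y : {set V})
    (m : {ffun V -> 'rV[rat]_d}) :
  (forall e, e \in E -> e.1 \in Y /\ e.2 \in Y) ->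
  stiff E D (F :|: ~: Y) -> motion E D m -> (forall x, x \in F -> m x = 0) ->
  forall x, x \in Y -> m x = 0.
Proof.
move=> EY st mE mF x xY.
pose m' : {ffun V -> 'rV[rat]_d} := [ffun x => if x \in Y then m x else 0].
suff /ffunP/(_ x) : m' = 0 by rewrite !ffunE xY.
apply: st => [e eE | z]; first by have [e1 e2] := EY e eE; rewrite !ffunE e1 e2 mE.
by rewrite !inE ffunE; case: ifP => // _ /orP[/mF|].
Qed.

Section Fogelsanger.
Variables (k : fieldType) (V : finType).
Implicit Types (c : {ffun {set V} -> k^o}) (S T F : {set V}) (A : {set {set V}}).

Local Notation s := (@incidence_sign V k).
Local Notation bd := (@bd_fun V k).

Definition edges_of A : {set V * V} :=
  [set e | [exists F in A, (e.1 \in F) && (e.2 \in F)]].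

Lemma edges_ofP A (x y : V) :
  reflect (exists F, [/\ F \in A, x \in F & y \in F]) ((x, y) \in edges_of A).
Proof.
rewrite inE; apply: (iffP (exists_inP)) => [[F FA /andP[]] | [F [FA xF yF]]].
  by exists F.
by exists F; rewrite //= xF.
Qed.

Lemma edges_of_sub A (B : {set {set V}}) : A \subset B -> edges_of A \subset edges_of B.
Proof.
move=> AB; apply/subsetP => -[x y] /edges_ofP[F [FA xF yF]].
by apply/edges_ofP; exists F; rewrite (subsetP AB).
Qed.

Lemma mem_verts c x : reflect (exists2 F, F \in supp c & x \in F) (x \in verts c).
Proof. exact: bigcupP. Qed.

Lemma bd_neq0 c T : bd c T != 0 -> exists2 x, x \notin T & x |: T \in supp c.
Proof.
move=> bT; apply: NNPP => no; move: bT; rewrite ffunE big1 ?eqxx // => x xT.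
have [-> |cx] := eqVneq (c (x |: T)) 0; first by rewrite mulr0.
by case: no; exists x; rewrite // suppE.
Qed.

Definition generic d (p : {ffun V -> 'rV[rat]_d}) :=
  forall E Z, generically_stiff d E Z -> stiff E (pdir p) Z.

Definition zero_faces d (m : {ffun V -> 'rV[rat]_d}) c : {set {set V}} :=
  [set F in supp c | [forall x in F, m x == 0]].

Lemma zero_facesP d (m : {ffun V -> 'rV[rat]_d}) c F :
  reflect (F \in supp c /\ forall x, x \in F -> m x = 0) (F \in zero_faces m c).
Proof.
rewrite [X in reflect _ X]in_set; apply: (iffP andP) => [[-> /forall_inP H] | [-> H]].
  by split=> // x /H /eqP.
by split=> //; apply/forall_inP => x /H ->.
Qed.

Lemma clique_vanish d (p : {ffun V -> 'rV[rat]_d}) E m S y :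
  generic p -> motion E (pdir p) m -> #|S| = d -> y \notin S ->
  (forall w, w \in S -> (y, w) \in E) -> (forall w, w \in S -> m w = 0) -> m y = 0.
Proof.
move=> gp mE cS yS SE mS.
pose mu : {ffun V -> 'rV[rat]_d} := [ffun x => if x == y then m y else 0].
suff /ffunP/(_ y) : mu = 0 by rewrite !ffunE eqxx.
apply: (gp _ _ (generically_stiff_star cS yS)) => [_ /imsetP[w wS ->] | z]; last first.
  by rewrite !inE ffunE => /negbTE->.
have wy : w != y by apply: contraNneq yS => <-.
by have := mE _ (SE w wS); rewrite /= !ffunE /= eqxx (negbTE wy) (mS w wS).
Qed.

(** * Contracting an edge of a minimal cycle *)

Section Step.
Variables (d : nat) (c : {ffun {set V} -> k^o}) (u v : V) (Fuv : {set V}).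
Variables (p m : {ffun V -> 'rV[rat]_d}).
Hypotheses (d_ge3 : (3 <= d)%N) (c_min : minimal_cycle c) (c_hom : homogeneous d c).
Hypothesis p_gen : generic p.
Hypothesis IH : forall c1, minimal_cycle c1 -> homogeneous d c1 ->
  (#|verts c1| < #|verts c|)%N -> forall F, F \in supp c1 ->
  generically_stiff d (edges_of (supp c1)) (F :|: ~: verts c1).
Hypotheses (uv : u != v) (Fuv_c : Fuv \in supp c) (uF : u \in Fuv) (vF : v \in Fuv).
Hypothesis m_motion : motion (edges_of (supp c)) (pdir p) m.

Let A := zero_faces m c.
Let fold x := if x == v then u else x.

(** The two faces are the ones that contraction merges. The vertex outside the first is joined to
    [S] by the second face and to the remaining vertex by [Fuv], so d bars to motionless points fix
    it. Thus the choice of [A] is compatible with the contraction. *)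
Lemma zero_faces_swap S : u \notin S -> v \notin S ->
  u |: S \in supp c -> v |: S \in supp c -> (u |: S \in A) = (v |: S \in A).
Proof.
move=> uS vS uSc vSc.
suff H x y : x != y -> x \notin S -> y \notin S -> x |: S \in supp c ->
    y |: S \in supp c -> x \in Fuv -> y \in Fuv -> x |: S \in A -> y |: S \in A.
  by apply/idP/idP; apply: H; rewrite // eq_sym.
move=> xy xS yS xSc ySc xF yF /zero_facesP[_ mx]; apply/zero_facesP; split=> // w.
rewrite in_setU1 => /predU1P[-> | wS]; last by apply: mx; rewrite in_setU1 wS orbT.
apply: (clique_vanish p_gen m_motion (c_hom xSc)) mx.
  by rewrite in_setU1 negb_or eq_sym xy.
move=> z; rewrite in_setU1 => /predU1P[-> | zS]; apply/edges_ofP; first by exists Fuv.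
by exists (y |: S); rewrite !in_setU1 eqxx zS orbT.
Qed.

(** The nondegenerate images of the faces of [A] under the map sending [v] to [u]. *)
Let A' := [set F : {set V} | (v \notin F) && ((F \in A) || (u \in F) && (v |: F :\ u \in A))].

Lemma in_A' F : (F \in A') =
  (v \notin F) && ((F \in A) || (u \in F) && (v |: F :\ u \in A)).
Proof. exact: in_set. Qed.

Lemma contract_restrict : contract u v (restrict A c) = restrict A' (contract u v c).
Proof.
apply/ffunP => F; rewrite !ffunE in_A'.
have [//|vF'] /= := boolP (v \in F).
have [uF'|uF'] /= := boolP (u \in F); last by rewrite orbF.
rewrite -[F in c F](setD1K uF') -[F in F \in A](setD1K uF').
set S := F :\ u.
have uS : u \notin S by rewrite !inE eqxx.
have vS : v \notin S by rewrite in_setD1 (negbTE vF') andbF.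
have [c1|c1] := boolP (u |: S \in supp c); have [c2|c2] := boolP (v |: S \in supp c).
- rewrite (zero_faces_swap uS vS c1 c2) orbb.
  by case: ifP => // _; rewrite mulr0 addr0.
- have -> : (v |: S \in A) = false by apply: contraNF c2 => /zero_facesP[].
  have -> : c (v |: S) = 0 by apply/eqP; rewrite suppE negbK in c2.
  by rewrite orbF !mulr0 !addr0.
- have -> : (u |: S \in A) = false by apply: contraNF c1 => /zero_facesP[].
  have -> : c (u |: S) = 0 by apply/eqP; rewrite suppE negbK in c1.
  by rewrite !add0r /=; case: ifP => // _; rewrite mulr0.
- have -> : (u |: S \in A) = false by apply: contraNF c1 => /zero_facesP[].
  have -> : (v |: S \in A) = false by apply: contraNF c2 => /zero_facesP[].
  by rewrite mulr0 addr0.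
Qed.

(** * Lifting a minimal cycle of the contraction *)

Section Component.
Variable (c1 : {ffun {set V} -> k^o}).
Hypotheses (c1_min : minimal_cycle c1) (c1_sub : supp c1 \subset supp (contract u v c)).

(** A preimage of [c1] under contraction with support inside [supp c]: a face containing [u] is kept
    when it lies in [supp c] and is otherwise moved to its twin containing [v], with the sign
    corrected. No face containing both [u] and [v] is used. *)
Let lift : {ffun {set V} -> k^o} := [ffun F : {set V} =>
  if v \in F then
    if (u \in F) || (u |: F :\ v \in supp c) then 0
    else s u (F :\ v) * s v (F :\ v) * c1 (u |: F :\ v)
  else if (u \in F) && (F \notin supp c) then 0 else c1 F].

Lemma comp_notin F : F \in supp c1 -> v \notin F.
Proof. by move/(subsetP c1_sub); rewrite suppE ffunE; case: ifP; rewrite ?eqxx. Qed.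

Lemma comp_off F : v \in F -> c1 F = 0.
Proof. by move=> vF'; apply/eqP; apply: contraTT vF'; rewrite -suppE => /comp_notin. Qed.

Lemma contract_lift : contract u v lift = c1.
Proof.
apply/ffunP => F; rewrite ffunE; case: ifPn => [/comp_off -> //|vF'].
case: ifPn => [uF'|uF']; last by rewrite ffunE (negbTE vF') (negbTE uF').
rewrite !ffunE (negbTE vF') uF' setU11 setU1K; last by rewrite in_setD1 (negbTE vF') andbF.
rewrite setD1K // in_setU1 (negbTE uv) in_setD1 eqxx /=.
case: (F \in supp c) => /=; first by rewrite mulr0 addr0.
by rewrite add0r !mulrA (AC (4*1) ((1*3)*(2*4)*5))/= !sign_sq !mul1r.
Qed.

Lemma lift_supp : supp lift \subset supp c.
Proof.
apply/subsetP => F; rewrite suppE ffunE; case: ifPn => [vF'|vF'].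
  case: ifPn => [|]; first by rewrite eqxx.
  rewrite negb_or => /andP[uF' nc]; rewrite mulf_eq0 negb_or => /andP[_].
  rewrite -suppE => /(subsetP c1_sub); rewrite suppE ffunE in_setU1 [v == u]eq_sym.
  rewrite (negbTE uv) in_setD1 eqxx /= setU11 setU1K; last first.
    by rewrite in_setD1 (negbTE uF') andbF.
  rewrite suppE negbK in nc; rewrite (eqP nc) add0r setD1K //.
  by rewrite mulf_eq0 negb_or suppE => /andP[].
case: ifPn => [|]; first by rewrite eqxx.
have [uF'|uF' _] /= := boolP (u \in F); first by rewrite negbK.
rewrite -suppE => /(subsetP c1_sub).
by rewrite !suppE ffunE (negbTE vF') (negbTE uF').
Qed.

Lemma lift_uv F : F \in supp lift -> u \in F -> v \in F -> False.
Proof. by rewrite suppE ffunE => + uF' vF'; rewrite uF' vF' eqxx. Qed.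

Lemma lift_face F : F \in supp c1 -> exists2 F0, F0 \in supp lift &
  F0 = F \/ u \in F /\ F0 = v |: F :\ u.
Proof.
move=> cF; have vF' := comp_notin cF.
have [Fl|Fl] := boolP (F \in supp lift); first by exists F; [|left].
have /ffunP/(_ F) := contract_lift; rewrite ffunE (negbTE vF').
move: Fl; rewrite suppE negbK => /eqP ->; rewrite suppE in cF.
case: ifP => [uF' E|_ E]; last by rewrite -E eqxx in cF.
exists (v |: F :\ u); last by right.
by apply: contraNT cF; rewrite suppE negbK -E => /eqP ->; rewrite mulr0 addr0.
Qed.

Lemma fold_face F : F \in supp lift ->
  F \in supp c1 \/ [/\ v \in F, u \notin F & u |: F :\ v \in supp c1].
Proof.
rewrite !suppE ffunE; case: ifPn => vF'; last first.
  by case: ifP; [rewrite eqxx | left].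
case: ifPn; first by rewrite eqxx.
rewrite negb_or => /andP[uF' _]; rewrite mulf_eq0 negb_or => /andP[_ cF].
by right; split.
Qed.

Lemma lift_A F F0 : F \in supp c1 -> F0 \in supp lift ->
  F0 = F \/ u \in F /\ F0 = v |: F :\ u -> (F \in A') = (F0 \in A).
Proof.
move=> cF F0l; have vF' := comp_notin cF; rewrite in_A' vF' /=.
have F0c := subsetP lift_supp _ F0l.
have [uF'|uF'] := boolP (u \in F); last by case=> [-> | []//]; rewrite orbF.
have := @zero_faces_swap (F :\ u); rewrite setD1K // !in_setD1 eqxx (negbTE vF') andbF.
move=> /(_ isT isT) sw.
have AN T : T \notin supp c -> T \in A = false by move=> nc; apply: contraNF nc => /zero_facesP[].
case=> [F0E | [_ F0E]]; rewrite F0E in F0c *.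
  have [c2|/AN ->] := boolP (v |: F :\ u \in supp c); last by rewrite orbF.
  by rewrite -sw // orbb.
have [c2|/AN -> //] := boolP (F \in supp c).
by rewrite sw // orbb.
Qed.

(** [lift] is nonzero and omits [Fuv], so by minimality of [c] it is not a cycle. Contraction kills
    its boundary, whose faces therefore contain exactly one of [u] and [v] and are matched by
    exchanging them. The link of [u] in this boundary is a nonzero cycle of sets of size d - 2, all
    of whose vertices are joined to both [u] and [v]; one such set and a new vertex of an adjacent
    one form [N]. *)
Lemma lift_common_neighbours : exists2 N : {set V}, #|N|.+1 = d &
  [/\ u \notin N, v \notin N, u \in verts lift, v \in verts lift &
   forall w, w \in N -> (u, w) \in edges_of (supp lift) /\
                        (v, w) \in edges_of (supp lift)].
Proof.
have [c1n c10 _] := c1_min; have [_ _ cmin] := c_min.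
have lift_n : lift != 0.
  apply: contraNneq c1n => l0; rewrite -contract_lift l0; apply/eqP/ffunP => F.
  by rewrite !ffunE mulr0 addr0 !if_same.
have bd_n : bd lift != 0.
  apply: contraTneq Fuv_c => l0; rewrite -(cmin _ lift_n l0 lift_supp).
  by apply/negP => /lift_uv /(_ uF vF).
have bd_c T : contract u v (bd lift) T = 0.
  by rewrite -bd_contract // contract_lift c10 ffunE.
have bd_uv T : bd lift T != 0 -> u \in T -> v \in T -> False.
  by move=> /bd_neq0[x xT /lift_uv]; rewrite !in_setU1 => H uT vT; apply: H; rewrite ?uT ?vT orbT.
have bd_swap S : u \notin S -> v \notin S ->
    (bd lift (u |: S) != 0) = (bd lift (v |: S) != 0).
  move=> uS vS; have := bd_c (u |: S).
  rewrite ffunE in_setU1 [v == u]eq_sym (negbTE uv) (negbTE vS) setU11 setU1K //= => E.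
  have -> : bd lift (u |: S) = - (s u S * s v S * bd lift (v |: S)).
    by apply/eqP; rewrite -addr_eq0 E.
  by rewrite oppr_eq0 !mulf_eq0 !(negbTE (sign_neq0 _ _ _)).
pose z := link_chain u (bd lift).
have z0 : bd z = 0.
  rewrite bd_link bd_bd; apply/ffunP => T; rewrite !ffunE mulr0 if_same oppr0 //.
have zP S : S \in supp z -> [/\ u \notin S, v \notin S,
    bd lift (u |: S) != 0 & bd lift (v |: S) != 0].
  rewrite suppE ffunE; case: ifPn => [|uS]; first by rewrite eqxx.
  rewrite mulf_eq0 negb_or => /andP[_ bS].
  have vS : v \notin S.
    by apply/negP => vS; apply: (bd_uv _ bS); rewrite !in_setU1 ?eqxx ?vS ?orbT.
  by rewrite -bd_swap.
have [S Sz] : exists S, S \in supp z.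
  have [T bT] : exists T, bd lift T != 0.
    move: bd_n; rewrite -supp_eq0 => /set0Pn[T]; rewrite suppE => ?; by exists T.
  have zS S : u \notin S -> bd lift (u |: S) != 0 -> S \in supp z.
    by move=> uS bS; rewrite suppE ffunE (negbTE uS) mulf_neq0 ?sign_neq0.
  have [uT|uT] := boolP (u \in T).
    by exists (T :\ u); apply: zS; rewrite ?setD1K // !inE eqxx.
  have [vT|vT] := boolP (v \in T); last first.
    by have := bd_c T; rewrite ffunE (negbTE vT) (negbTE uT) => E; rewrite E eqxx in bT.
  exists (T :\ v); have uS : u \notin T :\ v by rewrite in_setD1 (negbTE uT) andbF.
  by apply: zS => //; rewrite bd_swap ?setD1K // !inE eqxx.
have zcard T : T \in supp z -> #|T|.+2 = d.
  case/zP=> uT _ /bd_neq0[x xT xl] _; rewrite -(c_hom (subsetP lift_supp _ xl)).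
  by rewrite cardsU1 xT cardsU1 uT.
have zedge T w : T \in supp z -> w \in T -> (u, w) \in edges_of (supp lift) /\
                        (v, w) \in edges_of (supp lift).
  case/zP=> _ _ /bd_neq0[x _ xl] /bd_neq0[y _ yl] wT; split; apply/edges_ofP.
    by exists (x |: (u |: T)); rewrite !inE in xl *; rewrite xl eqxx wT !orbT.
  by exists (y |: (v |: T)); rewrite !inE in yl *; rewrite yl eqxx wT !orbT.
have /set0Pn[x xS] : S != set0.
  by rewrite -card_gt0; have := zcard S Sz; move: d_ge3 => + E; rewrite -E.
have [y yS ySz] := cycle_other z0 Sz xS.
have [uS vS /bd_neq0[a _ al] /bd_neq0[b _ bl]] := zP _ Sz.
have [uy vy _ _] := zP _ ySz.
exists (y |: S); first by rewrite cardsU1 yS zcard.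
rewrite !in_setU1 !negb_or uS vS !andbT; split.
- by apply: contraNneq uy => ->; rewrite setU11.
- by apply: contraNneq vy => ->; rewrite setU11.
- by apply/mem_verts; exists (a |: (u |: S)); rewrite // !inE eqxx orbT.
- by apply/mem_verts; exists (b |: (v |: S)); rewrite // !inE eqxx orbT.
move=> w; rewrite in_setU1 => /predU1P[-> |]; last exact: zedge.
by apply: zedge ySz _; rewrite setU11.
Qed.

Lemma lift_vertex F F0 x : F \in supp c1 ->
  F0 = F \/ u \in F /\ F0 = v |: F :\ u ->
  x \in F -> exists2 x0, x0 \in F0 & x = fold x0.
Proof.
move=> /comp_notin vF' HF xF; have xv : x != v by apply: contraNneq vF' => <-.
case: HF => [-> | [uF' ->]]; first by exists x; rewrite // /fold (negbTE xv).
have [-> |xu] := eqVneq x u; first by exists v; rewrite ?setU11 // /fold eqxx.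
by exists x; rewrite ?inE ?xu ?xF ?orbT // /fold (negbTE xv).
Qed.

(** Induction applies because [c1] lives on vertices of [c] other than [v]; a vertex split then
    carries rigidity back to the lift. The bar [uv] is adjoined since no face of [lift] contains
    both ends. *)
Lemma component_rigid F F0 : F \in supp c1 -> F0 \in supp lift ->
  F0 = F \/ u \in F /\ F0 = v |: F :\ u ->
  generically_stiff d ((u, v) |: edges_of (supp lift)) (F0 :|: ~: verts lift).
Proof.
move=> cF F0l HF.
have [N cN [uN vN ul vl NE]] := lift_common_neighbours.
have homog1 : homogeneous d c1.
  move=> G Gc; have [G0 G0l HG] := lift_face Gc.
  rewrite -(c_hom (subsetP lift_supp _ G0l)); case: HG => [-> // | [uG ->]].
  by rewrite cardsU1 (cardsD1 u G) uG in_setD1 (negbTE (comp_notin Gc)) andbF.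
have verts1 : (#|verts c1| < #|verts c|)%N.
  rewrite (cardsD1 v (verts c)).
  have -> : v \in verts c by apply/mem_verts; exists Fuv.
  rewrite add1n ltnS; apply: subset_leq_card; apply/subsetP => x /mem_verts[G Gc xG].
  rewrite in_setD1; apply/andP; split.
    by apply: contraNneq (comp_notin Gc) => <-.
  have [G0 G0l HG] := lift_face Gc; have G0c := subsetP lift_supp _ G0l.
  have [x0 x0G ->] := lift_vertex Gc HG xG; rewrite /fold; apply/mem_verts.
  by case: ifP => _; [exists Fuv | exists G0].
apply: (@generically_stiff_split d V _ (edges_of (supp c1)) _ (F :|: ~: verts c1) u v N) => //.
- exact: setU11.
- by move=> w /NE[uw vw]; rewrite !in_setU1 uw vw !orbT.
- move=> [x y] /edges_ofP[G [Gc xG yG]].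
  by split; apply: contraNneq (comp_notin Gc) => <-.
- move=> [x y] /edges_ofP[G [Gc xG yG]]; have [G0 G0l HG] := lift_face Gc.
  have [x0 x0G ->] := lift_vertex Gc HG xG; have [y0 y0G ->] := lift_vertex Gc HG yG.
  by exists (x0, y0) => //; rewrite in_setU1; apply/orP; right; apply/edges_ofP; exists G0.
- move=> z; rewrite !in_setU => /orP[zF _ | zc zv].
    by have [z0 z0F zE] := lift_vertex cF HF zF; exists z0; rewrite // in_setU z0F.
  exists z; last by rewrite /fold (negbTE zv).
  rewrite in_setU; apply/orP; right; rewrite !in_setC in zc *.
  apply: contra zc => /mem_verts[G /fold_face[Gc|[vG uG Gc]] zG]; apply/mem_verts.
    by exists G.
  by exists (u |: G :\ v); rewrite // !inE zv zG orbT.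
have [q qP] := IH c1_min homog1 verts1 cF.
by exists q; apply: stiff_sub qP => //; apply: subsetUr.
Qed.

(** The motion obeys all bars of the lift, and [uv] thanks to [Fuv], so vanishing on one lifted face
    spreads to all of them. This is the dichotomy that [restrict_cycle] asks for. *)
Lemma component_uniform : supp c1 \subset A' \/ [disjoint supp c1 & A'].
Proof.
have [dj|/pred0Pn[F /andP[/= cF FA']]] := boolP [disjoint supp c1 & A']; first by right.
left; have [F0 F0l HF] := lift_face cF.
have /zero_facesP[_ mF0] : F0 \in A by rewrite -(lift_A cF F0l HF).
have st := p_gen (component_rigid cF F0l HF).
have [N _ [_ _ ul vl _]] := lift_common_neighbours.
have mv : forall x, x \in verts lift -> m x = 0.
  apply: stiff_vanish st _ mF0.
    move=> [x y]; rewrite in_setU1 => /predU1P[[-> ->] //|/edges_ofP[G [Gl xG yG]]].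
    by split; apply/mem_verts; exists G.
  move=> e; rewrite in_setU1 => /predU1P[-> | el]; apply: m_motion.
    by apply/edges_ofP; exists Fuv.
  exact: subsetP (edges_of_sub lift_supp) _ el.
apply/subsetP => G Gc; have [G0 G0l HG] := lift_face Gc.
rewrite (lift_A Gc G0l HG); apply/zero_facesP; split.
  exact: subsetP lift_supp _ G0l.
by move=> x xG; apply: mv; apply/mem_verts; exists G0.
Qed.

End Component.

(** Contraction does not change the coefficient at a set missing [u] and [v], so the boundary may be
    computed after it, where the restriction is a cycle. *)
Lemma bd_zero_faces T : u \notin T -> v \notin T -> bd (restrict A c) T = 0.
Proof.
move=> uT vT; have [_ c0 _] := c_min.
have : contract u v (bd (restrict A c)) T = 0.
  rewrite -bd_contract // contract_restrict restrict_cycle ?ffunE //.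
    rewrite bd_contract // c0; apply/ffunP => F.
    by rewrite !ffunE mulr0 addr0 !if_same.
  by move=> c1 m1 s1; apply: component_uniform.
by rewrite ffunE (negbTE uT) (negbTE vT).
Qed.

End Step.

(* Contract an edge, apply induction to the minimal cycles that make up the contracted
   cycle and undo the contraction by vertex splitting.  The faces on which a motion
   vanishes form a subcycle, hence everything; this is checked at one ridge at a time,
   contracting an edge disjoint from it. *)
Lemma minimal_cycle_rigid d c : (3 <= d)%N -> minimal_cycle c -> homogeneous d c ->
  forall F, F \in supp c -> generically_stiff d (edges_of (supp c)) (F :|: ~: verts c).
Proof.
move=> d3; move: {2}_.+1 (ltnSn #|verts c|) => n.
elim: n c => // n IHn c cn c_min c_hom F0 F0c.
have [p pP] := generic_placement d V.
exists p => m mE mZ; pose A := zero_faces m c.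
have [_ c0 cmin] := c_min.
have F0A : F0 \in A.
  by apply/zero_facesP; split=> // x xF; apply: mZ; rewrite in_setU xF.
suff A0 : bd (restrict A c) = 0.
  have /setP AE : supp (restrict A c) = supp c.
    apply: cmin A0 _.
      rewrite -supp_eq0; apply/set0Pn; exists F0.
      by rewrite suppE ffunE F0A -suppE.
    apply/subsetP => F; rewrite !suppE ffunE; case: ifP => //.
    by rewrite eqxx.
  apply/ffunP => x; rewrite ffunE; have [/mem_verts[F Fc xF] | xc] := boolP (x \in verts c).
    have := AE F; rewrite Fc suppE ffunE; case: ifP; last by rewrite eqxx.
    by move=> /zero_facesP[_ mF] _; apply: mF.
  by apply: mZ; rewrite in_setU in_setC xc orbT.
apply/ffunP => T; rewrite [RHS]ffunE; apply/eqP; apply: contraT => AT.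
have [x xT] := bd_neq0 AT; rewrite suppE ffunE; case: ifP => [_|]; last by rewrite eqxx.
rewrite -suppE => xTc.
have cT : #|T|.+1 = d by rewrite -(c_hom _ xTc) cardsU1 xT.
have /set0Pn[r rT] : T != set0 by rewrite -card_gt0; move: d3; rewrite -cT; case: #|T|.
(* Replacing [r] by a new vertex [y] in [x |: T] produces a face with the two vertices [x] and [y]
   outside [T]; they will be the ends of the contracted edge. *)
have [F Fc F1] : exists2 F, F \in supp c & (1 < #|F :\: T|)%N.
  apply: NNPP => no.
  have [|y yF yc] := @cycle_other _ _ _ _ r c0 xTc; first by rewrite in_setU1 rT orbT.
  case: no; exists (y |: (x |: T) :\ r) => //.
  have yT : y \notin T by apply: contraNN yF => ?; rewrite in_setU1 orbC; apply/orP; left.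
  have yx : y != x by apply: contraNneq yF => ->; rewrite setU11.
  have rx : x != r by apply: contraNneq xT => ->.
  have -> : 2%N = #|[set x; y]| by rewrite cards2 eq_sym yx.
  apply: subset_leq_card; apply/subsetP => z; rewrite !inE.
  by case/orP => /eqP ->; rewrite ?eqxx ?xT ?yT ?rx ?orbT.
have /card_gt1P[u [v []]] := F1; rewrite !in_setD => /andP[uT uF] /andP[vT vF] uv.
case/negP: AT; apply/eqP; apply: (@bd_zero_faces d c u v F p m) => //.
by move=> c1 m1 h1 lt1; apply: IHn => //; apply: leq_trans lt1 _.
Qed.

End Fogelsanger.

(** * Doubly Cohen-Macaulay complexes *)

Section TwoCM.
Variables (k : fieldType) (V : finType).
Implicit Types (c : {ffun {set V} -> k^o}) (S T F : {set V}) (K L : {set {set V}}).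

Local Notation s := (@incidence_sign V k).
Local Notation bd := (@bd_fun V k).

Lemma mem_chains L q c :
  c \in chains k L q <-> supp c \subset L /\ homogeneous q c.
Proof.
split=> [/memv_sumP[f fP ->] | [cL cq]].
  suff H T : T \in supp (\sum_(S in L | #|S| == q) f S) -> T \in L /\ #|T| = q.
    by split=> [|T /H[]//]; apply/subsetP => T /H[].
  rewrite suppE sum_ffunE => H; apply: NNPP => no; move: H.
  rewrite big1 ?eqxx // => S /andP[SL /eqP Sq].
  have [|a ->] := vlineP _ _ (fP S _); first by rewrite SL Sq /=.
  rewrite !ffunE; case: eqP => [TS|_]; last exact: scaler0.
  by case: no; rewrite TS.
have -> : c = \sum_(S in L | #|S| == q) c S *: simplex k S.
  apply/ffunP => T; rewrite sum_ffunE.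
  have H S : S \in supp c -> (S \in L) && (#|S| == q).
    by move=> Sc; rewrite (subsetP cL) // cq ?eqxx.
  have [Tc|] := boolP (T \in supp c).
    rewrite (bigD1 T) /=; last exact: H.
    rewrite !ffunE eqxx big1 ?addr0 => [|S /andP[_ ST]]; first by rewrite /GRing.scale /= mulr1.
    by rewrite !ffunE eq_sym (negbTE ST) scaler0.
  rewrite suppE negbK => /eqP cT; rewrite cT big1 // => S _; rewrite !ffunE.
  by case: eqP => [<-|_]; rewrite ?cT ?scale0r ?scaler0.
by apply: memv_sumr => S SP; apply: memvZ; apply: memv_line.
Qed.

Lemma fill_cycle L q c : homology_vanishes k L q -> supp c \subset L ->
  homogeneous q c -> bd c = 0 ->
  exists b, [/\ supp b \subset L, homogeneous q.+1 b & bd b = c].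
Proof.
move=> hv cL cq c0; have : c \in cycles k L q.
  by rewrite memv_cap memv_ker /boundary lfunE /= c0 eqxx andbT; apply/mem_chains.
move/(subvP hv) => /memv_imgP[b /mem_chains[bL bq]] ->.
by exists b; split=> //; rewrite /boundary lfunE.
Qed.

Lemma pure_facet L S : pure L -> S \in L ->
  exists2 F, F \in L & S \subset F /\ #|F| = rank_cplx L.
Proof.
move=> pL SL; have [F Fm SF] := @maxset_exists _ (mem L) S SL.
by exists F; [exact: maxsetp Fm | split=> //; apply: pL].
Qed.

Lemma in_link L S F : (F \in link L S) = [disjoint S & F] && (S :|: F \in L).
Proof. exact: in_set. Qed.

Lemma in_deletion L v F : (F \in deletion L v) = (F \in L) && (v \notin F).
Proof. exact: in_set. Qed.

Lemma disjointsU1 (x : V) S T : [disjoint x |: S & T] = (x \notin T) && [disjoint S & T].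
Proof. by rewrite -!setI_eq0 setIUl setU_eq0 setI_eq0 disjoints1. Qed.

Lemma setUDK S F : S \subset F -> S :|: F :\: S = F.
Proof. by move=> SF; rewrite -{1}(setIidPr SF) setID. Qed.

Lemma rank_link L S : pure L -> S \in L ->
  (rank_cplx L <= #|S| + rank_cplx (link L S))%N.
Proof.
move=> pL SL; have [F FL [SF <-]] := pure_facet pL SL.
rewrite -(cardsID S F) (setIidPr SF) leq_add2l.
have FS : F :\: S \in link L S.
  rewrite in_link -setI_eq0 setIDA setIC -setIDA setDv setI0 eqxx.
  by rewrite setUDK.
exact: (@leq_bigmax_cond _ (mem (link L S)) (fun T => #|T|)).
Qed.

(** This 0-cycle starts the induction for minimal cycles in links, and filling it expresses the
    connectedness of a link. *)
Definition point_difference (a b : V) : {ffun {set V} -> k^o} :=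
  [ffun T : {set V} => if T == [set a] then 1 else if T == [set b] then -1 else 0].

Section PointDifference.
Variables a b : V.
Hypothesis ab : a != b.
Let c := point_difference a b.

Lemma supp_point_difference : supp c = [set [set a]; [set b]].
Proof.
apply/setP => T; rewrite suppE ffunE !inE.
case: (T =P [set a]) => _; first by rewrite oner_eq0.
by case: (T =P [set b]) => _; rewrite ?oppr_eq0 ?oner_eq0 // eqxx.
Qed.

Lemma point_difference_homogeneous : homogeneous 1 c.
Proof. by move=> T; rewrite supp_point_difference !inE => /orP[] /eqP ->; rewrite cards1. Qed.

Lemma sign_set0 v : s v set0 = 1.
Proof.
rewrite /incidence_sign.
suff -> : [set w in set0 | (enum_rank w < enum_rank v)%N] = set0 :> {set V}.
  by rewrite cards0.
by apply/setP => w; rewrite !inE.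
Qed.

Lemma bd_set0 (c1 : {ffun {set V} -> k^o}) : bd c1 set0 = \sum_x c1 [set x].
Proof.
rewrite ffunE; apply: eq_big => [x | x _]; first by rewrite inE.
by rewrite sign_set0 mul1r setU0.
Qed.

Lemma point_difference_cycle : bd c = 0.
Proof.
apply/ffunP => T; rewrite [RHS]ffunE; apply/eqP; apply: contraT => bT.
have [x xT xc] := bd_neq0 bT; have := point_difference_homogeneous xc.
rewrite cardsU1 xT => -[/cards0_eq T0]; rewrite {}T0 bd_set0 in bT.
move: bT; rewrite (bigD1 a) //= (bigD1 b) 1?eq_sym //= big1.
  by rewrite !ffunE !eqxx (inj_eq set1_inj) [b == a]eq_sym (negbTE ab) addr0 subrr eqxx.
move=> y /andP[ya yb].
by rewrite ffunE !(inj_eq set1_inj) (negbTE ya) (negbTE yb).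
Qed.

Lemma point_difference_minimal : minimal_cycle c.
Proof.
split.
  by rewrite -supp_eq0 supp_point_difference; apply/set0Pn; exists [set a]; rewrite !inE eqxx.
  exact: point_difference_cycle.
move=> c1 c1n c10; rewrite supp_point_difference => sub.
apply/eqP; rewrite eqEsubset sub /=; apply/subsetP => T.
move: c1n; rewrite -supp_eq0 => /set0Pn[F F1].
have [x Fx] : exists x, F = [set x].
  by have := subsetP sub _ F1; rewrite !inE => /orP[] /eqP ->; [exists a | exists b].
rewrite {}Fx in F1; have [y] := cycle_other c10 F1 (set11 x).
rewrite inE setDv setU0 => yx y1.
have := subsetP sub _ F1; have := subsetP sub _ y1; rewrite !inE !(inj_eq set1_inj).
rewrite -suppE => /orP[] /eqP yE /orP[] /eqP xE;
  by move: yx y1 F1; rewrite yE xE ?eqxx // => _ y1 F1 /orP[] /eqP ->.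
Qed.
End PointDifference.

Lemma supp_sub (c1 c2 : {ffun {set V} -> k^o}) F :
  F \in supp (c1 - c2) -> F \in supp c1 \/ F \in supp c2.
Proof.
rewrite !suppE !ffunE; have [->|] := eqVneq (c1 F) 0; last by left.
by rewrite sub0r oppr_eq0; right.
Qed.

Section Complex.
Variables (d : nat) (K : {set {set V}}).
Hypotheses (K_cplx : simplicial_complex K) (rK : rank_cplx K = d) (K_2CM : two_CM k K).

Let faceW S T : S \in K -> T \subset S -> T \in K.
Proof. exact: (proj2 K_cplx). Qed.

(* A minimal cycle in the link of [v] is the boundary of a chain avoiding [v], since
   deleting [v] preserves the Cohen-Macaulay property; together with the cone over
   the cycle it closes up to a cycle one dimension higher. *)
Lemma link_minimal_cycle T S a b : [disjoint S & T] -> a != b ->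
  a \notin S :|: T -> b \notin S :|: T ->
  a |: (S :|: T) \in K -> b |: (S :|: T) \in K -> (#|S| + #|T|).+1 = d ->
  exists c, [/\ minimal_cycle c, supp c \subset link K S, homogeneous #|T|.+1 c,
                a |: T \in supp c & b |: T \in supp c].
Proof.
move: {2}#|T| (erefl #|T|) => n; elim: n T S => [|n IH] T S Tn ST ab aN bN aK bK cd.
  have T0 := cards0_eq Tn; rewrite {}T0 !setU0 in ST aN bN aK bK cd *.
  exists (point_difference a b); split.
  - exact: point_difference_minimal.
  - rewrite supp_point_difference; apply/subsetP => F.
    rewrite in_set2 => /orP[] /eqP ->;
      by rewrite in_link disjoint_sym disjoints1 setUC ?aN ?bN.
  - by rewrite cards0; apply: point_difference_homogeneous.
  - by rewrite supp_point_difference !inE eqxx.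
  - by rewrite supp_point_difference !inE eqxx orbT.
have /set0Pn[v vT] : T != set0 by rewrite -card_gt0 Tn.
have vS : v \notin S by rewrite (disjointFl ST).
pose T' := T :\ v; have vT' : v \notin T' by rewrite !inE eqxx.
have T'n : #|T'| = n by move: Tn; rewrite (cardsD1 v) vT => -[].
have SvT : (v |: S) :|: T' = S :|: T by rewrite -setUA setUCA setD1K.
have [] := IH T' (v |: S) T'n; rewrite ?SvT //.
- rewrite disjointsU1 vT' /=; apply: disjointWr ST; exact: subsetDl.
- by rewrite cardsU1 vS T'n add1n addSnnS -Tn.
move=> c0 [c0_min c0K c0h ac0 bc0].
have [c0n c00 c0m] := c0_min; rewrite T'n in c0h.
have SvK : v |: (S :|: T) \in K -> [set v] \in K.
  by move=> H; apply: faceW H _; apply: subsetUl.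
have vK : [set v] \in K.
  by apply: faceW aK _; rewrite sub1set !inE vT !orbT.
have [_ /(_ v vK)[[pD hD] rD]] := K_2CM.
have SD : S \in deletion K v.
  rewrite in_deletion vS andbT; apply: faceW aK _.
  by apply/subsetP => x xS; rewrite !inE xS orbT.
have c0D F : F \in supp c0 -> v \notin F /\ F \in link (deletion K v) S.
  move=> /(subsetP c0K) cF; rewrite in_link disjointsU1 in cF.
  have /andP[/andP[vF SF] FK] := cF.
  split=> //; rewrite in_link in_deletion SF /= in_setU negb_or vS vF !andbT.
  by apply: faceW FK _; rewrite -setUA subsetUr.
(* The link has rank at least [d - #|S|], which is n + 2, so n + 1 lies strictly below the top
   degree. *)
have hv : homology_vanishes k (link (deletion K v) S) n.+1.
  apply: (hD _ SD); have := rank_link pD SD; by rewrite rD rK -cd Tn -addnS leq_add2l.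
have [e [eD eh e0]] := fill_cycle hv (introT subsetP (fun F cF => proj2 (c0D F cF))) c0h c00.
pose c := cone_chain v c0 - e.
have c_cyc : bd c = 0.
  by rewrite linearB /= e0 bd_cone ?subrr // => F /c0D[].
have ev F : F \in supp e -> v \notin F /\ F \in link K S.
  move=> /(subsetP eD); rewrite !in_link in_deletion in_setU negb_or => /and3P[-> -> /andP[_ ->]].
  by split.
have c_lk F : v \notin F -> c (v |: F) = s v F * c0 F.
  move=> vF; rewrite !ffunE setU11 setU1K //.
  have [->|] := eqVneq (e (v |: F)) 0; first by rewrite subr0.
  by rewrite -suppE => /ev[]; rewrite setU11.
have cone_supp F : F \in supp (cone_chain v c0) -> v \in F /\ F :\ v \in supp c0.
  rewrite !suppE ffunE; case: ifP; last by rewrite eqxx.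
  by move=> _; rewrite mulf_eq0 negb_or => /andP[].
have cK : supp c \subset link K S.
  apply/subsetP => F /supp_sub[/cone_supp[vF] | /ev[]//].
  move=> /(subsetP c0K); rewrite !in_link disjointsU1 => /andP[/andP[_ SF]].
  rewrite setUAC -setUA setUCA setUC -setUA; move=> FK; apply/andP; split.
    rewrite -(setD1K vF) disjoint_sym disjointsU1 vS disjoint_sym //.
  apply: faceW FK _; rewrite -{1}(setD1K vF); apply/subsetP => x; rewrite !inE.
  by case: (x \in S); case: (x == v); case: (x \in F).
have ch : homogeneous n.+2 c.
  move=> F /supp_sub[/cone_supp[vF /c0h] | /eh //].
  by rewrite (cardsD1 v F) vF => ->.
have swapT x : v |: (x |: T') = x |: T by rewrite setUCA setD1K.
have xN x : x \notin S :|: T -> x != v.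
  by apply: contraNneq => ->; rewrite !inE vT orbT.
have vx x : x \notin S :|: T -> v \notin x |: T'.
  by move=> /xN xv; rewrite in_setU1 negb_or eq_sym xv vT'.
have ac : a |: T \in supp c.
  by rewrite suppE -swapT c_lk ?vx // mulf_neq0 ?sign_neq0 // -suppE.
have [c1 [c1_min c1c ac1]] := minimal_cycle_through c_cyc ac.
exists c1; split=> //; first exact: subset_trans c1c cK.
  by move=> F /(subsetP c1c) /ch; rewrite Tn.
have [_ c10 _] := c1_min.
(* Passing to a minimal cycle through [a |: T] might lose [b |: T]. But the link of [v] in [c1] is a
   nonzero cycle inside [supp c0], hence has all of it as support by minimality of [c0], including
   [b |: T']. *)
have : supp (link_chain v c1) = supp c0.
  apply: c0m.
  - rewrite -supp_eq0; apply/set0Pn; exists (a |: T').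
    by rewrite suppE ffunE (negbTE (vx a aN)) mulf_neq0 ?sign_neq0 // swapT -suppE.
  - rewrite bd_link c10; apply/ffunP => F.
    by rewrite !ffunE mulr0 if_same oppr0.
  apply/subsetP => F; rewrite !suppE ffunE; case: ifPn => [|vF]; first by rewrite eqxx.
  rewrite mulf_eq0 negb_or => /andP[_ c1F].
  have := subsetP c1c (v |: F); rewrite !suppE c_lk // => /(_ c1F).
  by rewrite mulf_eq0 negb_or => /andP[].
move/setP/(_ (b |: T')); rewrite bc0 !suppE ffunE (negbTE (vx b bN)).
by rewrite mulf_eq0 negb_or swapT => /andP[].
Qed.

Section Motion.
Hypothesis d_ge3 : (3 <= d)%N.
Variables (p m : {ffun V -> 'rV[rat]_d}).
Hypotheses (p_gen : generic p) (m_motion : motion (edges_of K) (pdir p) m).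

Let vanishes F := forall x, x \in F -> m x = 0.

Lemma adjacent_vanish (R : {set V}) a b : #|R|.+1 = d -> a \notin R -> b \notin R ->
  a |: R \in K -> b |: R \in K -> vanishes (a |: R) -> vanishes (b |: R).
Proof.
move=> cR aR bR aK bK ma; have [<- //|ab] := eqVneq a b.
have [] := @link_minimal_cycle R set0 a b; rewrite ?set0U ?cards0 //.
  by rewrite -setI_eq0 set0I.
move=> c [c_min cK ch ac bc].
rewrite cR in ch; have st := p_gen (minimal_cycle_rigid d_ge3 c_min ch ac).
have cK' : supp c \subset K.
  by apply: subset_trans cK _; apply/subsetP => F; rewrite in_link set0U => /andP[].
move=> x xb; apply: stiff_vanish st _ ma _ _.
- move=> [y z] /edges_ofP[G [Gc yG zG]].
  by split; apply/mem_verts; exists G.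
- by move=> e ec; apply: m_motion; apply: subsetP (edges_of_sub cK') _ ec.
- by apply/mem_verts; exists (b |: R).
Qed.

(** Induction on the codimension of [S]: in codimension 1 the facets are adjacent, and in higher
    codimension one walks along edges of the link of [S], applying induction to [S] enlarged by one
    vertex at a time. *)
Lemma star_vanish S F F' : F \in K -> F' \in K -> #|F| = d -> #|F'| = d ->
  S \subset F -> S \subset F' -> vanishes F -> vanishes F'.
Proof.
move=> FK F'K cF cF' SF SF'; have [n dn] : exists n, (#|S| + n)%N = d.
  by exists (d - #|S|)%N; rewrite subnKC // -cF subset_leq_card.
elim: n S F F' FK F'K cF cF' SF SF' dn => [|[|n] IH] S F F' FK F'K cF cF' SF SF' dn.
- have eqS (G : {set V}) : #|G| = d -> S \subset G -> S = G.
    by move=> cG SG; apply/eqP; rewrite eqEcard SG cG -dn addn0 leqnn.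
  by rewrite -(eqS F) // -(eqS F').
- have one (G : {set V}) : #|G| = d -> S \subset G -> exists2 x, x \notin S & G = x |: S.
    move=> cG SG; have : #|G :\: S| == 1%N.
      by rewrite cardsD (setIidPr SG) cG -dn addnC addnK.
    case/cards1P => x Gx; exists x; last by rewrite setUC -Gx setUDK.
    have : x \in G :\: S by rewrite Gx set11.
    by rewrite in_setD => /andP[].
  have [a aS FE] := one F cF SF; have [b bS F'E] := one F' cF' SF'.
  by rewrite FE F'E in FK F'K *; apply: adjacent_vanish => //; rewrite -dn addn1.
have point (G : {set V}) : #|G| = d -> S \subset G -> exists x, x \in G :\: S.
  move=> cG SG; apply/set0Pn; rewrite -card_gt0 cardsD (setIidPr SG) cG -dn.
  by rewrite addnC addnK.
have [a] := point F cF SF; have [b] := point F' cF' SF'.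
rewrite !inE => /andP[bS bF'] /andP[aS aF] mF.
have IHx x (G G' : {set V}) : x \notin S -> G \in K -> G' \in K -> #|G| = d -> #|G'| = d ->
    x |: S \subset G -> x |: S \subset G' -> vanishes G -> vanishes G'.
  move=> xS GK G'K cG cG' xG xG'; apply: IH xG xG' _ => //.
  by rewrite cardsU1 xS -dn add1n addSnnS.
have xSub x (G : {set V}) : x \in G -> S \subset G -> x |: S \subset G.
  by rewrite subUset sub1set => -> ->.
have [ab|ab] := eqVneq a b.
  by apply: (IHx a F F'); rewrite ?xSub ?ab // -ab.
have [[pK hK] _] := K_2CM.
have SK : S \in K := faceW FK SF.
(* Degrees count vertices, so this is the vanishing of reduced homology in dimension 0; the link has
   rank at least n + 2. *)
have hv : homology_vanishes k (link K S) 1.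
  apply: hK => //; have := rank_link pK SK; rewrite rK -[X in (X <= _)%N]dn leq_add2l.
  exact: leq_trans.
have lk x (G : {set V}) : G \in K -> x \in G -> S \subset G -> x \notin S -> [set x] \in link K S.
  move=> GK xG SG xS; rewrite in_link disjoint_sym disjoints1 xS /=.
  by apply: faceW GK _; rewrite setUC xSub.
have abL : supp (point_difference a b) \subset link K S.
  rewrite supp_point_difference; apply/subsetP => T; rewrite in_set2.
  by case/orP => /eqP ->; [apply: lk aF _ _ | apply: lk bF' _ _].
have [e [eL eh e0]] :=
  fill_cycle hv abL (@point_difference_homogeneous a b) (point_difference_cycle ab).
(* By induction, vanishing on one facet containing [x |: S] gives vanishing on all of them. A facet
   through an edge [xy] of the link contains both [x |: S] and [y |: S], so [X] is closed under
   edges of [e]. *)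
pose X := [set x | [exists G in K, [&& #|G| == d, x |: S \subset G & [forall y in G, m y == 0]]]].
have XP x : x \in X <-> exists G, [/\ G \in K, #|G| = d, x |: S \subset G & vanishes G].
  rewrite inE; split=> [/exists_inP[G GK /and3P[/eqP cG xG /forall_inP mG]] | [G [GK cG xG mG]]].
    by exists G; split=> // y /mG /eqP.
  apply/exists_inP; exists G => //; rewrite cG eqxx xG; apply/forall_inP => y /mG ->.
  exact: eqxx.
have Xedge x y : x \in X -> [set x; y] \in supp e -> y \in X.
  move=> /XP[G [GK cG xG mG]] /(subsetP eL); rewrite in_link disjoint_sym => /andP[dj xyK].
  move: dj; rewrite disjointsU1 disjoints1 => /andP[xS yS].
  have [H HK [xyH cH]] := pure_facet pK xyK.
  have xyS z : z \in [set x; y] -> z |: S \subset H.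
    move=> zxy; apply: subset_trans xyH; rewrite subUset sub1set subsetUl andbT.
    by rewrite in_setU zxy orbT.
  apply/XP; exists H; split; rewrite ?xyS ?set22 ?cH //.
  by apply: (IHx x G H); rewrite ?xyS ?set21 ?cH.
have aX : a \in X by apply/XP; exists F; rewrite xSub.
have [/XP[G [GK cG bG mG]] | bX] := boolP (b \in X).
  by apply: (IHx b G F') => //; apply: xSub.
(* If [b] were outside [X], the part of [e] inside [X] would have the single point [a] as boundary,
   whose augmentation is 1; this contradicts [bd_bd]. *)
pose eX := restrict [set E : {set V} | E \subset X] e.
have eX0 x : bd eX [set x] = if x \in X then point_difference a b [set x] else 0.
  rewrite -e0 !ffunE; case: ifPn => xX; last first.
    by rewrite big1 // => y _; rewrite ffunE inE subUset !sub1set (negbTE xX) andbF mulr0.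
  apply: eq_bigr => y _; rewrite ffunE inE subUset !sub1set xX andbT.
  case: ifPn => // yX; congr (_ * _); apply/esym/eqP; apply: contraNT yX => ey.
  by apply: Xedge xX _; rewrite suppE setUC.
have /ffunP/(_ set0) := bd_bd eX; rewrite bd_set0 [RHS]ffunE (bigD1 a) //= big1.
  by rewrite eX0 aX ffunE eqxx addr0 => /eqP; rewrite oner_eq0.
move=> x xa; rewrite eX0; case: ifPn => // xX; rewrite ffunE !(inj_eq set1_inj) (negbTE xa).
by case: eqP => // xb; rewrite -xb xX in bX.
Qed.
End Motion.

Lemma complex_stiff (p : {ffun V -> 'rV[rat]_d}) F0 :
  (3 <= d)%N -> generic p -> F0 \in K -> #|F0| = d ->
  stiff (edges_of K) (pdir p) (F0 :|: ~: [set x | [set x] \in K]).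
Proof.
move=> d3 gp F0K cF0 m mE mZ; apply/ffunP => x; rewrite [RHS]ffunE.
have [xK|xK] := boolP ([set x] \in K); last by apply: mZ; rewrite !inE xK orbT.
have [[pK _] _] := K_2CM; have [F FK [xF cF]] := pure_facet pK xK.
apply: (star_vanish d3 gp mE F0K FK cF0 _ (sub0set _) (sub0set _)).
- by rewrite cF.
- by move=> y yF; apply: mZ; rewrite inE yF.
- by rewrite -sub1set.
Qed.

End Complex.
End TwoCM.

(** * Face numbers *)

Section Counting.
Variables (k : fieldType) (V : finType) (d : nat) (K : {set {set V}}).
Hypotheses (d_ge3 : (3 <= d)%N) (K_cplx : simplicial_complex K).
Hypotheses (rK : rank_cplx K = d) (K_2CM : two_CM k K).

Let vertices := [set x | [set x] \in K].

Lemma num_faces1 : num_faces K 1 = #|vertices|.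
Proof.
rewrite /num_faces -(card_imset _ (@set1_inj V)); congr (#|pred_of_set _|).
apply/setP => S; rewrite inE; apply/andP/imsetP => [[SK /cards1P[x Sx]] | [x + ->]].
  by exists x; rewrite // inE -Sx.
by rewrite inE cards1.
Qed.

Lemma face_sub_vertices S : S \in K -> S \subset vertices.
Proof.
move=> SK; apply/subsetP => x xS; rewrite inE.
by apply: (proj2 K_cplx) SK _; rewrite sub1set.
Qed.

Lemma num_faces2_le : (num_faces K 2 <= 'C(num_faces K 1, 2))%N.
Proof.
rewrite num_faces1 -cards_draws; apply: subset_leq_card; apply/subsetP => S.
by rewrite !inE => /andP[/face_sub_vertices -> ->].
Qed.

Lemma facet_exists S : S \in K -> exists2 F, F \in K & S \subset F /\ #|F| = d.
Proof. by have [[pK _] _] := K_2CM; rewrite -rK; apply: pure_facet. Qed.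

(** Deleting a vertex [v] keeps the rank, so some facet avoids [v]; with [v] it gives d + 1
    vertices. This makes g_1 nonnegative. *)
Lemma num_faces1_gt : (d < num_faces K 1)%N.
Proof.
rewrite num_faces1; have [F FK [_ cF]] := facet_exists (proj1 K_cplx).
have /set0Pn[v vF] : F != set0 by rewrite -card_gt0 cF; apply: leq_trans d_ge3.
have vK : [set v] \in K by apply: (proj2 K_cplx) FK _; rewrite sub1set.
have [_ /(_ v vK)[[pD _] rD]] := K_2CM.
have D0 : set0 \in deletion K v by rewrite in_deletion (proj1 K_cplx) inE.
have [G GD [_ cG]] := pure_facet pD D0.
rewrite in_deletion in GD; have /andP[GK vG] := GD.
have -> : d.+1 = #|v |: G| by rewrite cardsU1 vG cG rD rK.
by apply: subset_leq_card; rewrite subUset sub1set inE vK face_sub_vertices.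
Qed.

(* Edges inside the facet on which the motions are pinned do not contribute. *)
Lemma num_faces2_ge : (num_faces K 1 * d + 'C(d, 2) <= num_faces K 2 + d * d)%N.
Proof.
have [F FK [_ cF]] := facet_exists (proj1 K_cplx).
have [p gp] := generic_placement d V.
have st := complex_stiff K_cplx rK K_2CM d_ge3 gp FK cF.
(* Orienting by [enum_rank] lists each edge once, so that [#|E|] counts edges. *)
pose E := [set e : V * V | [&& (enum_rank e.1 < enum_rank e.2)%N,
  [set e.1; e.2] \in K & ~~ ([set e.1; e.2] \subset F)]].
have {}st : stiff E (pdir p) (F :|: ~: vertices).
  move=> m mE mZ; apply: (st m _ mZ) => -[x y] /edges_ofP[G [GK xG yG]].
  have [xyF|xyF] := boolP ([set x; y] \subset F).
    move: xyF; rewrite subUset !sub1set => /andP[xF yF].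
    by rewrite /= !mZ ?inE ?xF ?yF // subrr mul0mx.
  have xyK : [set x; y] \in K.
    by apply: (proj2 K_cplx) GK _; rewrite subUset !sub1set xG.
  case: (ltngtP (enum_rank x) (enum_rank y)) => lt.
  - by apply: (mE (x, y)); rewrite inE /= lt xyK.
  - have := mE (y, x); rewrite inE /= lt setUC xyK xyF => /(_ isT).
    rewrite !ffunE /= => yx; rewrite -[m x - m y]opprB -[p x - p y]opprB.
    by rewrite [(- _)^T]linearN /= mulNmx mulmxN yx !oppr0.
  - by rewrite (enum_rank_inj (val_inj lt)) /= subrr mul0mx.
have cE : (#|E| + 'C(d, 2) <= num_faces K 2)%N.
  rewrite /num_faces -(cardsID [set S : {set V} | S \subset F]) addnC -cF -cards_draws.
  apply: leq_add.
    apply: subset_leq_card; apply/subsetP => S; rewrite !inE => /andP[SF ->].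
    by rewrite SF andbT (proj2 K_cplx F S FK SF).
  have inj : {in E &, injective (fun e : V * V => [set e.1; e.2])}.
    move=> [x y] [x' y']; rewrite !inE /= => /and3P[xy _ _] /and3P[xy' _ _] /setP eqS.
    have := eqS x; have := eqS y; rewrite !inE !eqxx orbT /=.
    case/esym/orP => /eqP ey; case/esym/orP => /eqP ex; rewrite ?ex ?ey // in xy *.
    - by rewrite ltnn in xy.
    - by have := ltn_trans xy xy'; rewrite ltnn.
    - by rewrite ltnn in xy.
  rewrite -(card_in_imset inj); apply: subset_leq_card; apply/subsetP => S.
  case/imsetP => -[x y]; rewrite inE /= => /and3P[xy xyK xyF] ->.
  rewrite !inE xyF xyK cards2; suff -> : x != y by [].
  by apply: contraTneq xy => ->; rewrite ltnn.
(* Elements of [V] that are not vertices are pinned, and so cancel against [#|V|] in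
   [stiff_count]. *)
have cZ : (#|F :|: ~: vertices| + num_faces K 1 <= d + #|V|)%N.
  have [+ _] := leq_card_setU F (~: vertices).
  by have := cardsC vertices; rewrite num_faces1 cF; lia.
have := stiff_count st; have := leq_mul cZ (leqnn d); rewrite !mulnDl; move: cE.
move: #|E| #|F :|: ~: vertices| #|V| (num_faces K 1) (num_faces K 2) ('C(d, 2)).
lia.
Qed.

End Counting.

(** * From face numbers to g-numbers and order ideals of monomials *)

Lemma coef_XsubC_exp n i : (i <= n)%N ->
  (('X - 1) ^+ n : {poly int})`_(n - i) = (-1) ^+ i * 'C(n, i)%:R.
Proof.
move=> le_in; have signE j : (-1) ^+ j = ((-1) ^+ j)%:P :> {poly int}.
  by rewrite rmorphXn /= polyCN.
rewrite exprBn coef_sum (bigD1 (inord i)) //= inordK // big1 => [|j ji].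
  by rewrite coefMn expr1n mulr1 addr0 mulr_natr signE coefCM coefXn eqxx mulr1.
rewrite coefMn expr1n mulr1 signE coefCM coefXn.
suff -> : (n - i == n - j)%N = false by rewrite mulr0 mul0rn.
apply: contraNF ji => /eqP ij; apply/eqP/val_inj; rewrite /= inordK ?ltnS //.
by have := ltn_ord j; lia.
Qed.

Lemma h_numE (V : finType) (K : {set {set V}}) j : (j <= rank_cplx K)%N ->
  h_num K j = \sum_(i < j.+1)
    (num_faces K i)%:Z * ((-1) ^+ (j - i) * 'C(rank_cplx K - i, j - i)%:Z).
Proof.
move=> jd; rewrite /h_num /h_poly coef_sum.
rewrite [RHS](big_ord_widen _ (fun i => (num_faces K i)%:Z *
  ((-1) ^+ (j - i) * 'C(rank_cplx K - i, j - i)%:Z)) (_ : (j < (rank_cplx K).+1)%N)) //.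
rewrite [RHS]big_mkcond; apply: eq_bigr => i _; rewrite coefZ; case: ltnP => ij.
  have -> : (rank_cplx K - j = (rank_cplx K - i) - (j - i))%N by lia.
  by rewrite coef_XsubC_exp ?leq_sub2r // !natz.
rewrite nth_default ?mulr0 // size_exp_XsubC.
by have := ltn_ord i; lia.
Qed.

(** Once all monomials of degree at most 1 in [a] variables are present, any [b] of the C(a+1,2)
    quadratic ones complete them to an order ideal. *)
Lemma M_sequence3 (a b : nat) : (b <= 'C(a.+1, 2))%N -> M_sequence [:: 1; a%:Z; b%:Z].
Proof.
move=> le_b; pose basis2 := [seq s2m t | t : 2.-tuple 'I_a <- enum (basis a 2)].
have size2 : size (take b basis2) = b.
  rewrite size_take_min; apply/minn_idPl.
  rewrite /basis2; case: a le_b {basis2} => [|a'] le_b; last by rewrite size_basis.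
  by move: le_b; rewrite bin_small // leqn0 => /eqP ->.
have deg2 m : m \in take b basis2 -> mdeg m = 2%N.
  by move/mem_take => mB; apply/eqP; rewrite basis_cover.
pose s : seq 'X_{1..a} := 0%MM :: [seq U_(i)%MM | i <- enum 'I_a] ++ take b basis2.
have s_uniq : uniq s.
  rewrite cons_uniq mem_cat negb_or cat_uniq take_uniq ?uniq_basis // andbT.
  rewrite map_inj_in_uniq ?enum_uniq /=; last first.
    by move=> i j _ _ /eqP; rewrite eq_mnm1 => /eqP.
  apply/andP; split; first (apply/andP; split).
  - by apply/negP => /mapP[i _ /eqP]; rewrite eq_sym mnm1_eq0.
  - by apply/negP => /deg2; rewrite mdeg0.
  - by apply/hasPn => m /deg2 m2; apply/negP => /mapP[i _ mi]; rewrite mi mdeg1 in m2.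
have s_small m : (mdeg m <= 1)%N -> m \in s.
  rewrite leq_eqVlt ltnS leqn0 mdeg_eq0 => /orP[/mdeg1P[i /eqP ->] | /eqP ->]; rewrite inE ?eqxx //.
  by rewrite mem_cat map_f ?orbT ?mem_enum.
have s_deg m : m \in s -> (mdeg m < 3)%N.
  rewrite inE mem_cat => /or3P[/eqP -> | /mapP[i _ ->] | /deg2 ->] //.
  - by rewrite mdeg0.
  - by rewrite mdeg1.
pose M := seq_fset tt s.
exists a, M; split.
- by apply/fset0Pn; exists 0%MM; rewrite seq_fsetE s_small ?mdeg0.
- move=> m m'; rewrite !seq_fsetE => ms le_m; have def_m := submK le_m.
  have [|lt1] := leqP (mdeg m') 1; first exact: s_small.
  have := s_deg m ms; rewrite -{1}def_m mdegD => lt3.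
  have /eqP : mdeg (m - m')%MM = 0%N by lia.
  by rewrite mdeg_eq0 => /eqP m0; rewrite -[m']add0m -m0 def_m.
- have cnt (i : nat) : #|` [fset m in M | mdeg m == i]%fset | = count (fun m => mdeg m == i) s.
    rewrite -size_filter -(undup_id (filter_uniq _ s_uniq)) -(size_seq_fset tt).
    congr (size (val _)); apply/fsetP => m.
    by rewrite [RHS]seq_fsetE mem_filter -[m \in s](seq_fsetE tt s) [RHS]andbC inE.
  have cntU (i : nat) : count (fun m : 'X_{1..a} => mdeg m == i) [seq U_(j)%MM | j <- enum 'I_a] =
      if i == 1%N then a else 0%N.
    rewrite count_map; under eq_count => j do rewrite /= mdeg1.
    by rewrite eq_sym; case: (i == 1%N); rewrite ?count_predT ?size_enum_ord ?count_pred0.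
  have cnt2 (i : nat) : count (fun m : 'X_{1..a} => mdeg m == i) (take b basis2) =
      if i == 2%N then b else 0%N.
    rewrite (@eq_in_count _ _ (fun=> i == 2%N)) => [|m /deg2 ->]; last exact: eq_sym.
    by case: (i == 2%N); rewrite ?count_predT ?size2 ?count_pred0.
  by case=> [|[|[|//]]] _; rewrite cnt /= mdeg0 count_cat cntU cnt2 /= ?addn0.
by move=> m; rewrite seq_fsetE => /s_deg.
Qed.

Local Close Scope ring_scope.

Theorem theorem1p2 (d : nat) (V : finType) (K : {set {set V}}) (k : fieldType) :
  (4 <= d)%N ->
  simplicial_complex K ->
  rank_cplx K = d ->
  two_CM k K ->
  M_sequence [:: g_num K 0; g_num K 1; g_num K 2].
Proof.
move=> d4 Kc rK K2; have d3 : (3 <= d)%N := ltnW d4.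
case: d rK d4 d3 => [|[|e]] // rK d4 d3.
have := @h_numE V K 0; have := @h_numE V K 1; have := @h_numE V K 2.
rewrite rK !big_ord_recl !big_ord0 /= => /(_ isT) h2 /(_ isT) h1 /(_ isT) h0.
rewrite !subn0 !subnn !bin0 !bin1 !expr0 !addr0 /= in h0 h1 h2.
have lt := num_faces1_gt d3 Kc rK K2; have ge := num_faces2_ge d3 Kc rK K2.
have le := num_faces2_le Kc.
have f0 : num_faces K 0 = 1%N.
  rewrite /num_faces -(cards1 (set0 : {set V})); congr (#|pred_of_set _|).
  apply/setP => S; rewrite !inE cards_eq0; case: eqP => [-> | _]; last by rewrite andbF.
  by rewrite (proj1 Kc).
have bin2E n : (2 * 'C(n.+1, 2) = n.+1 * n)%N by rewrite -mul_bin_diag bin1.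
move: (num_faces K 1) (num_faces K 2) h1 h2 lt ge le => n f2 h1 h2 lt ge le.
rewrite f0 in h0 h1 h2.
have binS3 : 'C(e.+3, 2) = 'C(e.+2, 2) + e.+2 by rewrite binS bin1.
(* Here the rank is e + 2, and [a] and [b] are g_1 and g_2 as natural numbers; for [b] the lower
   bound is used with d^2 = C(d,2) + C(d+1,2). *)
have [a na] : exists a, n = (a + e.+3)%N by exists (n - e.+3)%N; rewrite subnK.
have [b fb] : exists b, (f2 + 'C(e.+3, 2) = b + e.+2 * n)%N.
  exists (f2 + 'C(e.+3, 2) - e.+2 * n)%N; rewrite subnK //.
  by move: ge (bin2E e.+1); rewrite binS3; lia.
rewrite /bump /= !expr1 sqrrN expr1n !mul1r !mulr1 /= in h0 h1 h2.
have g1 : (h_num K 1 - h_num K 0 = a%:Z)%R by rewrite h1 h0; lia.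
have g2 : (h_num K 2 - h_num K 1 = b%:Z)%R.
  by rewrite h2 h1 addn0 subn1 /=; move: fb; rewrite binS3; lia.
rewrite g1 g2 h0.
apply: M_sequence3; move: le; rewrite na addnS.
have := bin2E a; have := bin2E e.+2; have := bin2E (a + e.+2)%N; lia.
Qed.
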